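(* Let $m,n\ge 1$ and let $\mathbf{x}=(x_i^j)_{i\in[m],j\in[n]}$. As rational functions in the $x_i^j$, $$\Delta(\mathbf{x})=\sum_{j=1}^{\min(m-1,n)}\widetilde{Q}_1^{(j)}+\delta_{m,n}E_1^{(n)},\qquad F\bigl(Q(\mathbf{x})\bigr)=\sum_{j=1}^{\min(m-1,n)}\widetilde{Q}_1^{(j)},$$ where $\Delta(\mathbf{x})=F(\mathbf{x})-F(P(\mathbf{x}))$ is the central charge and $\delta_{m,n}$ is the Kronecker delta.
   Context: $[k]=\{1,\dots,k\}$. The $x_i^j$ ($i\in[m],j\in[n]$) are independent indeterminates over $\mathbb{C}$; for $r\in\mathbb{Z}$, $x_i^{(r)}=x_i^j$ where $j\in[n]$, $j\equiv r-i+1\pmod n$. $\mathbf{x}_i=(x_i^1,\dots,x_i^n)$. $E_1^{(r)}=\sum_{i=1}^m x_i^{(r)}$. Geometric RSK: for $y=(y_1,\dots,y_n)$ let $W(y)$ be the $n\times n$ matrix with diagonal $y_1,\dots,y_n$, $1$'s in positions $(a+1,a)$, zeros elsewhere, and $M(\mathbf{x}_1,\dots,\mathbf{x}_k)=W(\mathbf{x}_1)\cdots W(\mathbf{x}_k)$. For $I\subseteq[n]$, $\Delta_I(A)$ is the minor of $A$ with rows $I$ and columns $1,\dots,|I|$ ($\Delta_\emptyset=1$). The $P$-pattern $P(\mathbf{x})=(z_{i,j})_{1\le i\le m,\ i\le j\le n}$ and $Q$-pattern $Q(\mathbf{x})=(z'_{j,i})_{1\le j\le n,\ j\le i\le m}$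 are $$z_{i,j}=\frac{\Delta_{[i,j]}(M(\mathbf{x}_1,\dots,\mathbf{x}_m))}{\Delta_{[i+1,j]}(M(\mathbf{x}_1,\dots,\mathbf{x}_m))},\qquad z'_{j,i}=\frac{\Delta_{[j,n]}(M(\mathbf{x}_1,\dots,\mathbf{x}_i))}{\Delta_{[j+1,n]}(M(\mathbf{x}_1,\dots,\mathbf{x}_i))}.$$ Decorations: $F(\mathbf{x})=\sum_{i\in[m],j\in[n]}x_i^j$; $$F(P)=\sum_{\substack{1\le i\le m\\ i\le j\le n-1}}\frac{z_{i,j+1}}{z_{i,j}}+\sum_{\substack{1\le i\le m-1\\ i\le j\le n-1}}\frac{z_{i,j}}{z_{i+1,j+1}}+\mathbf{1}_{m<n}\,z_{m,m};$$ $$F(Q)=\sum_{\substack{1\le j\le n\\ j\le i\le m-1}}\frac{z'_{j,i+1}}{z'_{j,i}}+\sum_{\substack{1\le j\le n-1\\ j\le i\le m-1}}\frac{z'_{j,i}}{z'_{j+1,i+1}}+\mathbf{1}_{n<m}\,z'_{n,n}.$$ Loop skew Schur functions: $s^{(r)}_{\lambda/\mu}=\sum_T\prod_{s\in\lambda/\mu}x_{T(s)}^{(c(s)+r)}$ over semistandard Young tableaux $T$ of shape $\lambda/\mu$ with entries in $[m]$, where a cell $s$ in row $a$, column $b$ (English notation) has $c(s)=a-b$; equals $1$ if $\lambda=\mu$. Shape invariants: $S_k=s^{(n)}_{((n-k+1)^{m-k+1})}$ for $1\le k\le p:=\min(m,n)$ (rectangle with $m-k+1$ rows of length $n-k+1$),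 $S_{p+1}=1$. Reduced $Q$-invariants: for $i\in[m],j\in[n]$ with $i+j\le m$, let $0\le K\le n-1$, $K\equiv i+j-m-1\pmod n$, $\lambda_i^j=((n-j+K+1)^{m-n+K},(n-j)^{m-i-j})$, $\mu_i^j=((n-j+1)^{m-n+K-i})$ (exponents are multiplicities), and $\widetilde{Q}_i^{(j)}=s^{(n-j+1)}_{\lambda_i^j/\mu_i^j}/(S_{j+1}S_{n+1-K})$. *)

(* Defs.v *)
From HB Require Import structures.
From mathcomp Require Import all_boot all_order all_algebra fraction.
From mathcomp Require Import reals complex mpoly.

Set Implicit Arguments.
Unset Strict Implicit.
Unset Printing Implicit Defensive.

Import Order.TTheory GRing.Theory Num.Theory.
Local Open Scope ring_scope.

(* Conventions. The variables form a matrix x : 'M[F]_(m, n), whose ordinal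
   indices are 0-based: x_i^j is x i' j' with i = i'.+1 and j = j'.+1.
   Indices of type nat (of patterns, minors, shape invariants, ...) are
   1-based, so that the formulas read as in the mathematical text. *)

(* The field C(x_i^j) of rational functions in m * n indeterminates over
   C = R[i], and the matrix of these indeterminates. *)
Definition ratfun (R : realType) (m n : nat) : fieldType :=
  {fraction {mpoly R[i][m * n]}}.

Definition indets (R : realType) (m n : nat) : 'M[ratfun R m n]_(m, n) :=
  \matrix_(i < m, j < n) tofrac ('X_(mxvec_index i j) : {mpoly R[i][m * n]}).

(* x_i^(r): for n >= 1 there is exactly one column j congruent to r - i + 1,
   so the default value is never used. *)
Definition xsup (F : fieldType) (m n : nat) (x : 'M[F]_(m, n))
    (i : 'I_m) (r : int) : F :=
  if [pick j : 'I_n | (j.+1%:Z == r - i.+1%:Z + 1 %[mod n%:Z])%Z] is Some j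
  then x i j else 0.

Definition E1 (F : fieldType) (m n : nat) (x : 'M[F]_(m, n)) (r : int) : F :=
  \sum_(i < m) xsup x i r.

Definition Wmx (F : fieldType) (n : nat) (y : 'rV[F]_n) : 'M[F]_n :=
  \matrix_(a < n, b < n)
    if a == b then y 0 a else if a == b.+1 :> nat then 1 else 0.

(* M(x_1, ..., x_k), for k <= m; the factors occur in increasing order of i. *)
Definition Mmx (F : fieldType) (m n : nat) (x : 'M[F]_(m, n)) (k : nat) :
    'M[F]_n :=
  \big[mulmx/1%:M]_(i < m | (i < k)%N) Wmx (row i x).

Lemma card_set_ord_le (n : nat) (I : {set 'I_n}) : (#|I| <= n)%N.
Proof. by rewrite -[leqRHS]card_ord max_card. Qed.

(* enum_val enumerates the rows in I increasingly. *)
Definition Delta (F : fieldType) (n : nat) (I : {set 'I_n}) (A : 'M[F]_n) : F :=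
  \det (\matrix_(a < #|I|, b < #|I|)
          A (enum_val a) (widen_ord (card_set_ord_le I) b)).

Definition itvset (n a b : nat) : {set 'I_n} :=
  [set c : 'I_n | (a <= c.+1 <= b)%N].

(* The patterns are total functions of i and j; only their values at
   1 <= i <= m, i <= j <= n (resp. 1 <= j <= n, j <= i <= m) are meaningful. *)
Definition Ppat (F : fieldType) (m n : nat) (x : 'M[F]_(m, n)) (i j : nat) : F :=
  Delta (itvset n i j) (Mmx x m) / Delta (itvset n i.+1 j) (Mmx x m).

Definition Qpat (F : fieldType) (m n : nat) (x : 'M[F]_(m, n)) (j i : nat) : F :=
  Delta (itvset n j n) (Mmx x i) / Delta (itvset n j.+1 n) (Mmx x i).

Definition decorX (F : fieldType) (m n : nat) (x : 'M[F]_(m, n)) : F :=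
  \sum_(i < m) \sum_(j < n) x i j.

Definition decorP (F : fieldType) (m n : nat) (z : nat -> nat -> F) : F :=
    \sum_(1 <= i < m.+1) \sum_(i <= j < n) z i j.+1 / z i j
  + \sum_(1 <= i < m) \sum_(i <= j < n) z i j / z i.+1 j.+1
  + (if (m < n)%N then z m m else 0).

Definition decorQ (F : fieldType) (m n : nat) (z : nat -> nat -> F) : F :=
    \sum_(1 <= j < n.+1) \sum_(j <= i < m) z j i.+1 / z j i
  + \sum_(1 <= j < n) \sum_(j <= i < m) z j i / z j.+1 i.+1
  + (if (n < m)%N then z n n else 0).

Definition central_charge (F : fieldType) (m n : nat) (x : 'M[F]_(m, n)) : F :=
  decorX x - decorP m n (Ppat x).

(* Cells of the skew shape lam / mu, as (row, column) with 0-based coordinates;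
   lam and mu are partitions given by their lists of parts, so that head 0 lam
   is the largest part of lam. *)
Definition skew_cell (lam mu : seq nat) : finType :=
  {c : 'I_(size lam) * 'I_(head 0%N lam)
     | (nth 0%N mu c.1 <= c.2 < nth 0%N lam c.1)%N}.

Definition cell_row (lam mu : seq nat) (c : skew_cell lam mu) : nat := (val c).1.
Definition cell_col (lam mu : seq nat) (c : skew_cell lam mu) : nat := (val c).2.

(* Same value with 0-based as with 1-based coordinates. *)
Definition content (lam mu : seq nat) (c : skew_cell lam mu) : int :=
  (cell_row c)%:Z - (cell_col c)%:Z.

(* The letter k of [m] is encoded by the ordinal k.-1 of 'I_m. *)
Definition ssyt (m : nat) (lam mu : seq nat)
    (T : {ffun skew_cell lam mu -> 'I_m}) : bool :=
  [forall s, forall t,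
     ((cell_row s == cell_row t) && (cell_col s <= cell_col t)%N
        ==> (T s <= T t)%N)
  && ((cell_col s == cell_col t) && (cell_row s < cell_row t)%N
        ==> (T s < T t)%N)].

Definition loop_schur (F : fieldType) (m n : nat) (x : 'M[F]_(m, n))
    (r : int) (lam mu : seq nat) : F :=
  \sum_(T : {ffun skew_cell lam mu -> 'I_m} | ssyt T)
    \prod_(s : skew_cell lam mu) xsup x (T s) (content s + r).

Definition shape_inv (F : fieldType) (m n : nat) (x : 'M[F]_(m, n)) (k : nat) : F :=
  if (k <= minn m n)%N
  then loop_schur x n%:Z (nseq (m - k + 1)%N (n - k + 1)%N) [::]
  else 1.

Definition redK (m n i j : nat) : nat :=
  absz (((i + j)%:Z - m%:Z - 1) %% n%:Z)%Z.

(* For i, j >= 1 with j <= n and i + j <= m, the congruence defining K gives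
   m + K - n >= i + j - 1, so no natural subtraction below is truncated. *)
Definition red_lam (m n i j : nat) : seq nat :=
  let K := redK m n i j in
  nseq (m + K - n)%N (n - j + K + 1)%N ++ nseq (m - (i + j))%N (n - j)%N.

Definition red_mu (m n i j : nat) : seq nat :=
  let K := redK m n i j in
  nseq (m + K - n - i)%N (n - j + 1)%N.

Definition Qred (F : fieldType) (m n : nat) (x : 'M[F]_(m, n)) (i j : nat) : F :=
  loop_schur x (n%:Z - j%:Z + 1) (red_lam m n i j) (red_mu m n i j)
  / (shape_inv x j.+1 * shape_inv x (n + 1 - redK m n i j)%N).

(* Main.v *)
(* All quantities are expressed through left-justified minors of the products
   M_k = W(x_1) ... W(x_k).  Let D(a, N) be the minor on rows a, ..., a+N-1 and
   columns 0, ..., N-1 (0-based), H(a, N) the ratio of the minor on rows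
   a, a+2, ..., a+N to D(a+1, N), and C(a, N) the ratio of the minor on columns
   0, ..., N-2, N to D(a, N).  Three-term Pluecker relations make the terms of
   F(P) successive differences of H and C in a and N, and those of F(Q)
   successive differences of H and C in k, up to single variables.  Both sums
   telescope, and both F(P) and F(Q) become explicit in H and C for k = m.
     On the other side, cut the shape lambda_1^j / mu_1^j at the single cell
   joining its two rectangular parts, of shapes S_{j+1} and S_{n+1-K}.  The
   letter c of that cell must be >= the top right letter a of the first
   rectangle and <= the bottom left letter b of the second one.  Since c < a
   and c > b exclude each other,
     [a <= c <= b] = 1 - [c < a] - [c > b],
   and each of the three terms is a product of minors by nonintersecting
   paths, which gives Q_1^(j) = E_1^(j) - H(j-1, n-j) - C(n-K, K). *)
Require Import Defs.
From HB Require Import structures.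
From mathcomp Require Import all_boot all_order all_algebra fraction.
From mathcomp Require Import reals complex mpoly.
From mathcomp Require Import perm boolp ring zify.

Set Implicit Arguments.
Unset Strict Implicit.
Unset Printing Implicit Defensive.

Import Order.TTheory GRing.Theory Num.Theory.
Local Open Scope ring_scope.

(** * Pluecker relations *)

(** The formula for Q_1^(j) does not match the decorations term by term: its C term sits at row n -
    K, where K is congruent to j - m modulo n. The map j -> n - K permutes 1, ..., min(m-1, n), so
    the agreement holds only after summation over j. The other obstacle is that the superscript of
    E_1^(r) is cyclic, whereas minors involve plain variables. An entry of M_k next to its extreme
    subdiagonal supplies the letters for which the superscript does not wrap; the single variables
    left over by the recurrence in k supply those for which it does. In F(X) - F(P), the E_1^(r)
    with r > m cancel against the values of C at the corner a = m, and E_1^(m) cancels against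
    z_{m,m} when m < n. For m > n no such terms occur. Only m = n leaves E_1^(n) over, which
    explains the Kronecker delta. All identities are proved over an arbitrary field under the
    assumption that the minors D(a, N) of M_k with a <= k and a + N <= n are nonzero; for
    indeterminates this follows by specializing them to 0 and 1. *)

Section ColumnDeterminants.
Variable R : comNzRingType.
Implicit Types (g v : nat -> nat -> R) (u w : nat -> R).

(* [g c] is the column of index [c]; only the first N entries of the first N
   columns matter. *)
Definition dcol N g : R := \det (\matrix_(r < N, c < N) g c r).

Lemma eq_dcol N g g' :
  (forall c r, (c < N)%N -> (r < N)%N -> g c r = g' c r) ->
  dcol N g = dcol N g'.
Proof.
move=> eq_g; congr (\det _); apply/matrixP => r c.
by rewrite !mxE eq_g ?ltn_ord.
Qed.

Definition vcons u g : nat -> nat -> R :=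
  fun c => if c is c'.+1 then g c' else u.

Definition vrcons N g u : nat -> nat -> R :=
  fun c => if (c < N)%N then g c else u.

Definition unitv i : nat -> R := fun r => (r == i)%:R.

Lemma dcol_cons N u g :
  dcol N.+1 (vcons u g) =
  \sum_(i < N.+1) u i * ((-1) ^+ i * dcol N (fun c r => g c (bump i r))).
Proof.
rewrite /dcol (expand_det_col _ ord0); apply: eq_bigr => i _.
rewrite mxE /cofactor /= addn0; congr (_ * (_ * \det _)).
by apply/matrixP => r c; rewrite !mxE.
Qed.

Lemma dcol_rcons N u g :
  dcol N.+1 (vrcons N g u) =
  \sum_(i < N.+1) u i * ((-1) ^+ (i + N) * dcol N (fun c r => g c (bump i r))).
Proof.
rewrite /dcol (expand_det_col _ ord_max); apply: eq_bigr => i _.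
rewrite mxE /cofactor /vrcons /= ltnn; congr (_ * (_ * \det _)).
apply/matrixP => r c; rewrite !mxE /=.
have lt_c := ltn_ord c.
by rewrite /bump (leqNgt N c) lt_c add0n lt_c.
Qed.

Lemma dcol_rot N u g :
  dcol N.+1 (vcons u g) = (-1) ^+ N * dcol N.+1 (vrcons N g u).
Proof.
rewrite dcol_cons dcol_rcons big_distrr; apply: eq_bigr => i _ /=.
rewrite [RHS]mulrCA; congr (_ * _); rewrite mulrA -exprD; congr (_ * _).
by rewrite addnCA exprD addnn -[X in _ * X]signr_odd odd_double mulr1.
Qed.

Lemma dcol_unitv N i g : (i <= N)%N ->
  dcol N.+1 (vcons (unitv i) g) =
  (-1) ^+ i * dcol N (fun c r => g c (bump i r)).
Proof.
move=> le_iN; rewrite dcol_cons (bigD1 (Ordinal (le_iN : i < N.+1)%N)) //=.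
rewrite big1 ?addr0 /unitv ?eqxx ?mul1r // => j.
by rewrite -val_eqE /= => /negPf ->; rewrite mul0r.
Qed.

Lemma dcol_rconsD N (a : R) u w g :
  dcol N.+1 (vrcons N g (fun r => a * u r + w r)) =
  a * dcol N.+1 (vrcons N g u) + dcol N.+1 (vrcons N g w).
Proof.
rewrite !dcol_rcons big_distrr -big_split; apply: eq_bigr => i _ /=.
by rewrite mulrDl mulrA.
Qed.

(** Passing from M to M W(y) replaces column c by [y c * v c + v c.+1]. With the old column [v 0]
    kept in front, this is a unitriangular change of columns, which makes minors of consecutive
    products comparable. *)
Lemma dcol_colop N (y : nat -> R) v :
  dcol N.+1 (vcons (v 0%N) (fun c r => y c * v c r + v c.+1 r)) = dcol N.+1 v.
Proof.
pose U : 'M[R]_N.+1 := \matrix_(c, d)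
  (if c == d then 1 else if c.+1 == d :> nat then y c else 0).
have detU : \det U = 1.
  rewrite -det_tr det_trig ?big1 // => [i _|]; first by rewrite !mxE eqxx.
  apply/is_trig_mxP => i j lt_ij; rewrite !mxE.
  have /negPf-> : j != i by rewrite -val_eqE /= gtn_eqF.
  by have /negPf-> : j.+1 != i :> nat by lia.
rewrite -[RHS]mulr1 -detU -det_mulmx; congr (\det _).
apply/matrixP => r c; rewrite !mxE.
case: c => [[|c] lt_c] /=.
  rewrite (bigD1 ord0) //= big1 => [|k neq_k]; first by rewrite !mxE /= mulr1 addr0.
  by case: k neq_k => [[|k] lt_k] // _; rewrite !mxE /= mulr0.
have lt_c' : (c < N.+1)%N by lia.
rewrite (bigD1 (Ordinal lt_c)) //= (bigD1 (Ordinal lt_c')) /=; last first.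
  by rewrite -val_eqE /= ; lia.
rewrite !mxE /= eqxx mulr1 -val_eqE /= (ltn_eqF (ltnSn c)) eqxx big1 => [|k].
  by rewrite addr0 addrC mulrC.
rewrite -!val_eqE /= => /andP[/negPf ne1 /negPf ne2].
by rewrite !mxE -val_eqE /= ne1 eqSS ne2 mulr0.
Qed.

End ColumnDeterminants.

Section GrassmannPluecker.
Variables (F : fieldType) (K : nat) (B : nat -> nat -> F).
Implicit Types p q u w : nat -> F.

Definition dcol2 u w : F := dcol K.+2 (vcons u (vcons w B)).

(* Modulo the span of the columns of B, any two vectors have coordinates in the
   basis p, q of a two-dimensional quotient. *)
Lemma dcol2_coord p q : dcol2 p q != 0 ->
  exists f g : (nat -> F) -> F,
    forall u w, dcol2 u w = dcol2 p q * (f u * g w - f w * g u).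
Proof.
rewrite {1}/dcol2 /dcol.
set X : 'M_K.+2 := (X in \det X) => X0.
have uX : X \in unitmx by rewrite unitmxE unitfE.
pose y u : 'cV[F]_K.+2 := invmx X *m \col_r u r.
pose f u := y u ord0 0; pose g u := y u (lift ord0 ord0) 0.
exists f, g => u w.
(* Coordinates of u, w and the columns of [B] in the basis p, q, [B]. All columns but two are unit
   vectors, so the determinant reduces to the upper left 2 x 2 block. *)
pose Z : 'M[F]_(2 + K) := \matrix_(r, c)
  if c == 0%N :> nat then y u r 0 else if c == 1%N :> nat then y w r 0
  else (r == c)%:R.
have -> : f u * g w - f w * g u = \det Z.
  have urZ : ursubmx Z = 0 by apply/matrixP => -[[|[|r]] lt_r] c; rewrite !mxE.
  have drZ : drsubmx Z = 1%:M by apply/matrixP => r c; rewrite !mxE.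
  have -> : Z = block_mx (ulsubmx Z) 0 (dlsubmx Z) 1%:M by rewrite -urZ -drZ submxK.
  rewrite det_lblock det1 mulr1.
  rewrite (expand_det_row _ ord0) !big_ord_recl big_ord0 addr0 /cofactor.
  rewrite !det_mx11 !mxE /= expr0 mul1r expr1 mulN1r mulrN.
  rewrite (_ : lshift K ord0 = ord0); last exact: val_inj.
  rewrite (_ : lshift K (lift ord0 ord0) = lift ord0 ord0); last exact: val_inj.
  by rewrite /f /g !mxE.
rewrite /dcol2 /dcol -det_mulmx; congr (\det _).
have yK v : X *m y v = \col_r v r by rewrite mulKVmx.
apply/matrixP => r c; rewrite !mxE.
have [c0|c_neq0] := eqVneq (c : nat) 0%N.
  rewrite c0 /=; have /matrixP/(_ r 0) := yK u.
  by rewrite !mxE => <-; apply: eq_bigr => k _; rewrite !mxE c0.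
have [c1|c_neq1] := eqVneq (c : nat) 1%N.
  rewrite c1 /=; have /matrixP/(_ r 0) := yK w.
  by rewrite !mxE => <-; apply: eq_bigr => k _; rewrite !mxE c1.
rewrite (bigD1 c) //= !mxE (negPf c_neq0) (negPf c_neq1) eqxx mulr1 big1 ?addr0.
  by case: c c_neq0 c_neq1 => [[|[|c]] lt_c].
by move=> k ne_kc; rewrite !mxE (negPf c_neq0) (negPf c_neq1) (negPf ne_kc) mulr0.
Qed.

Lemma dcol2_pluecker p q u w : dcol2 p q != 0 ->
  dcol2 p q * dcol2 u w - dcol2 p u * dcol2 q w + dcol2 p w * dcol2 q u = 0.
Proof.
move=> /dcol2_coord[f [g fgE]].
rewrite (fgE u w) (fgE p u) (fgE q w) (fgE p w) (fgE q u).
have [->|pq0] := eqVneq (dcol2 p q) 0; first by rewrite !mul0r subrr addr0.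
have /(mulfI pq0) fg1 : dcol2 p q * 1 = dcol2 p q * (f p * g q - f q * g p).
  by rewrite mulr1 -fgE.
set d := dcol2 p q.
(* The 2 x 2 Pluecker identity in the coordinates leaves the last factor, and [fgE p q] itself says
   that this factor is 0. *)
transitivity (d * d * (f u * g w - f w * g u) * (1 - (f p * g q - f q * g p))).
  by ring.
by rewrite -fg1 subrr mulr0.
Qed.

Lemma dcol2C p q u w : dcol2 p q != 0 -> dcol2 u w = - dcol2 w u.
Proof.
by move=> /dcol2_coord[f [g fgE]]; rewrite (fgE u w) (fgE w u); ring.
Qed.

End GrassmannPluecker.

Section MinorIdentities.
Variables (F : fieldType) (K : nat).
Implicit Types (v B : nat -> nat -> F) (u w y : nat -> F).

(** A unit vector in front deletes its row, and the sign comes from rotating the other vector to the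
    last place. This lemma and the next ones translate brackets into minors in this way. *)
Lemma dcol2_unitv0 B u :
  dcol2 K B (unitv F 0) u =
  (-1) ^+ K * dcol K.+1 (fun c r => vrcons K B u c r.+1).
Proof.
rewrite /dcol2 dcol_unitv // mul1r.
rewrite (_ : dcol _ _ = dcol K.+1 (vcons (fun r => u r.+1) (fun c r => B c r.+1))).
  rewrite dcol_rot; congr (_ * _); apply: eq_dcol => c r _ _.
  by rewrite /vrcons; case: ifP.
by apply: eq_dcol => -[].
Qed.

Lemma dcol2_unitv1 B u :
  dcol2 K B (unitv F 1) u =
  - ((-1) ^+ K * dcol K.+1 (fun c r => vrcons K B u c (bump 1 r))).
Proof.
rewrite /dcol2 dcol_unitv // expr1 mulN1r; congr (- _).
rewrite (_ : dcol _ _ =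
  dcol K.+1 (vcons (fun r => u (bump 1 r)) (fun c r => B c (bump 1 r)))).
  rewrite dcol_rot; congr (_ * _); apply: eq_dcol => c r _ _.
  by rewrite /vrcons; case: ifP.
by apply: eq_dcol => -[].
Qed.

Lemma dcol2_unitv_last B u :
  dcol2 K B (unitv F K.+1) u = - dcol K.+1 (vrcons K B u).
Proof.
rewrite /dcol2 dcol_unitv //.
rewrite (_ : dcol _ _ = dcol K.+1 (vcons u B)).
  rewrite dcol_rot mulrA exprS mulN1r mulNr -exprD addnn.
  by rewrite -[X in - X]signr_odd odd_double mulNr mul1r.
by apply: eq_dcol => c r _ lt_r; rewrite /bump leqNgt lt_r.
Qed.

Lemma dcol2_unitv01 B :
  dcol2 K B (unitv F 0) (unitv F 1) = dcol K (fun c r => B c r.+2).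
Proof.
rewrite /dcol2 dcol_unitv // mul1r.
rewrite (_ : dcol _ _ = dcol K.+1 (vcons (unitv F 0) (fun c r => B c r.+1))).
  by rewrite dcol_unitv // mul1r.
by apply: eq_dcol => -[].
Qed.

Lemma dcol2_unitv0_last B :
  dcol2 K B (unitv F 0) (unitv F K.+1) =
  (-1) ^+ K * dcol K (fun c r => B c r.+1).
Proof.
rewrite /dcol2 dcol_unitv // mul1r.
rewrite (_ : dcol _ _ = dcol K.+1 (vcons (unitv F K) (fun c r => B c r.+1))).
  rewrite dcol_unitv //; congr (_ * _).
  by apply: eq_dcol => c r _ lt_r; rewrite /bump leqNgt lt_r.
by apply: eq_dcol => -[].
Qed.

Lemma dcol2_unitv1_last B : (0 < K)%N ->
  dcol2 K B (unitv F 1) (unitv F K.+1) =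
  - ((-1) ^+ K * dcol K (fun c r => B c (bump 1 r))).
Proof.
move=> K_gt0; rewrite /dcol2 dcol_unitv // expr1 mulN1r; congr (- _).
rewrite (_ : dcol _ _ = dcol K.+1 (vcons (unitv F K) (fun c r => B c (bump 1 r)))).
  rewrite dcol_unitv //; congr (_ * _).
  by apply: eq_dcol => c r _ lt_r; rewrite /(bump K) leqNgt lt_r.
apply: eq_dcol => -[|c] r _ _ //=; rewrite /unitv /bump.
by congr (_%:R); lia.
Qed.

Lemma dcol2_last2 v w :
  dcol2 K v (v K) w = dcol K.+2 (vrcons K.+1 v w).
Proof.
rewrite /dcol2 dcol_rot.
rewrite (_ : dcol _ _ = dcol K.+2 (vcons w v)).
  rewrite dcol_rot mulrA -exprD addnn -[X in X * _]signr_odd odd_double mul1r //.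
apply: eq_dcol => -[|c] r lt_c _ //=; rewrite /vrcons /=.
by case: ifP => //; rewrite ltnS => ?; congr (v _ r); lia.
Qed.

Lemma dcol_vrcons_id v (f : nat -> nat) :
  dcol K.+1 (fun c r => vrcons K v (v K) c (f r)) =
  dcol K.+1 (fun c r => v c (f r)).
Proof.
apply: eq_dcol => c r lt_c _; rewrite /vrcons; case: ifP => // ?.
by congr (v _ _); lia.
Qed.

Lemma dcol_vrcons_bump v (f : nat -> nat) :
  dcol K.+1 (fun c r => vrcons K v (v K.+1) c (f r)) =
  dcol K.+1 (fun c r => v (bump K c) (f r)).
Proof.
apply: eq_dcol => c r lt_c _; rewrite /vrcons /bump; case: ifP => ?;
  by congr (v _ _); lia.
Qed.

Let signM : (-1) ^+ K * (-1) ^+ K = 1 :> F.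
Proof. by rewrite -expr2 sqrr_sign. Qed.

(** The three-term relation for e_0, v_K, e_{K+1}, v_{K+1} modulo v_0, ..., v_{K-1}. *)
Lemma minor_desnanot v :
  dcol K.+1 (fun c r => v c r.+1) != 0 ->
  dcol K (fun c r => v c r.+1) * dcol K.+2 v
    + dcol K.+1 (fun c r => v c r.+1) * dcol K.+1 (fun c r => v (bump K c) r)
    - dcol K.+1 (fun c r => v (bump K c) r.+1) * dcol K.+1 v = 0.
Proof.
move=> d0.
have e0v : dcol2 K v (unitv F 0) (v K) =
    (-1) ^+ K * dcol K.+1 (fun c r => v c r.+1).
  by rewrite dcol2_unitv0 (dcol_vrcons_id v S).
have nz : dcol2 K v (unitv F 0) (v K) != 0 by rewrite e0v mulf_neq0 ?signr_eq0.
have := dcol2_pluecker (unitv F K.+1) (v K.+1) nz.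
rewrite e0v (dcol2_unitv0 v (v K.+1)) (dcol_vrcons_bump v S) dcol2_last2 dcol2_unitv0_last.
rewrite (dcol2C (v K) (unitv F K.+1) nz) !dcol2_unitv_last.
rewrite (dcol_vrcons_id v id) (dcol_vrcons_bump v id).
rewrite (_ : dcol K.+2 (vrcons K.+1 v (v K.+1)) = dcol K.+2 v); last first.
  by apply: eq_dcol => c r lt_c _; rewrite /vrcons; case: ifP => // ?;
    congr (v _ _); lia.
move: signM => ss; set s := (-1) ^+ K in ss * => E.
by rewrite -[RHS](mulr0 (- s)) -E; ring: ss.
Qed.

(** The three-term relation for e_0, v_K, e_1, e_{K+1} modulo v_0, ..., v_{K-1}; for K = 0 the last
    two vectors would coincide. *)
Lemma minor_flag v : (0 < K)%N -> dcol K.+1 (fun c r => v c r.+1) != 0 ->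
  dcol K (fun c r => v c r.+2) * dcol K.+1 v
    + dcol K.+1 (fun c r => v c r.+1) * dcol K (fun c r => v c (bump 1 r))
    - dcol K (fun c r => v c r.+1) * dcol K.+1 (fun c r => v c (bump 1 r)) = 0.
Proof.
move=> K_gt0 d0.
have e0v : dcol2 K v (unitv F 0) (v K) =
    (-1) ^+ K * dcol K.+1 (fun c r => v c r.+1).
  by rewrite dcol2_unitv0 (dcol_vrcons_id v S).
have nz : dcol2 K v (unitv F 0) (v K) != 0 by rewrite e0v mulf_neq0 ?signr_eq0.
have := dcol2_pluecker (unitv F 1) (unitv F K.+1) nz.
rewrite e0v dcol2_unitv1_last // dcol2_unitv01 (dcol2C (v K) (unitv F K.+1) nz).
rewrite dcol2_unitv0_last (dcol2C (v K) (unitv F 1) nz) dcol2_unitv1.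
rewrite dcol2_unitv_last (dcol_vrcons_id v id) (dcol_vrcons_id v (bump 1)) => E.
move: signM E => ss; set s := (-1) ^+ K in ss * => E.
by rewrite -[RHS]oppr0 -E; ring: ss.
Qed.

(* If v lists the columns of M, then w lists those of M W(y). *)
Section NextLetter.
Variables (v : nat -> nat -> F) (y : nat -> F).
Let w c r := y c * v c r + v c.+1 r.

Lemma dcol2_rot B u z :
  dcol2 K B u z = (-1) ^+ K * dcol K.+2 (vcons u (vrcons K B z)).
Proof.
rewrite /dcol2 !dcol_cons big_distrr; apply: eq_bigr => i _ /=.
rewrite [RHS]mulrCA; congr (_ * _); rewrite [RHS]mulrCA; congr (_ * _).
rewrite (_ : dcol _ _ =
  dcol K.+1 (vcons (fun r => z (bump i r)) (fun c r => B c (bump i r)))).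
  rewrite dcol_rot; congr (_ * _); apply: eq_dcol => c r _ _.
  by rewrite /vrcons; case: ifP.
by apply: eq_dcol => -[].
Qed.

Lemma dcol2_unitv_col0 i : (i <= K.+1)%N ->
  dcol2 K w (unitv F i) (v 0%N) =
  (-1) ^+ i * dcol K.+1 (fun c r => v c (bump i r)).
Proof.
move=> le_i; rewrite /dcol2 dcol_unitv //; congr (_ * _).
rewrite -(dcol_colop K y (fun c r => v c (bump i r))).
by apply: eq_dcol => -[].
Qed.

Lemma dcol2_col0 z :
  dcol2 K w (v 0%N) z = (-1) ^+ K * dcol K.+2 (vrcons K.+1 v z).
Proof.
rewrite dcol2_rot; congr (_ * _).
(* The coefficients are cut off at K so that the last column [z] is not altered. *)
rewrite -(dcol_colop K.+1 (fun c => if (c < K)%N then y c else 0) (vrcons K.+1 v z)).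
apply: eq_dcol => -[|c] r lt_c _ //=; rewrite /vrcons !ltnS.
by have [lt_cK|le_Kc] := ltnP c K; rewrite ?mul0r ?add0r // (ltnW lt_cK).
Qed.

Lemma dcol2_col0_last : dcol2 K w (v 0%N) (w K) = (-1) ^+ K * dcol K.+2 v.
Proof.
rewrite dcol2_rot -(dcol_colop K.+1 y v); congr (_ * _).
apply: eq_dcol => -[|c] r lt_c _ //=; rewrite /vrcons; case: ifP => // ?.
by have -> : c = K by lia.
Qed.

(** The three-term relation for e_0, v_0, e_1, w_K modulo the new columns w_0, ..., w_{K-1}. The
    presence of v_0 turns mixed brackets back into minors of the old product. *)
Lemma minor_flag_next : dcol K.+1 (fun c r => v c r.+1) != 0 ->
  dcol K (fun c r => w c r.+2) * dcol K.+2 v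
    + dcol K.+1 (fun c r => v c r.+1) * dcol K.+1 (fun c r => w c (bump 1 r))
    - dcol K.+1 (fun c r => w c r.+1) * dcol K.+1 (fun c r => v c (bump 1 r))
  = 0.
Proof.
move=> d0.
have e0v : dcol2 K w (unitv F 0) (v 0%N) = dcol K.+1 (fun c r => v c r.+1).
  by rewrite dcol2_unitv_col0 // mul1r.
have nz : dcol2 K w (unitv F 0) (v 0%N) != 0 by rewrite e0v.
have := dcol2_pluecker (unitv F 1) (w K) nz.
rewrite e0v dcol2_unitv1 dcol2_unitv01 dcol2_col0_last.
rewrite (dcol2_unitv0 w (w K)) (dcol2C (v 0%N) (unitv F 1) nz).
rewrite dcol2_unitv_col0 // (dcol_vrcons_id w S) (dcol_vrcons_id w (bump 1)).
move: signM => ss; set s := (-1) ^+ K in ss * => E.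
by rewrite -[RHS](mulr0 (- s)) -E; ring: ss.
Qed.

(** As before, now for e_0, v_0, w_K, w_{K+1}. *)
Lemma minor_desnanot_next : dcol K.+1 (fun c r => v c r.+1) != 0 ->
  dcol K.+1 (fun c r => v c r.+1) * dcol K.+2 w
    - dcol K.+1 (fun c r => w c r.+1)
      * (y K.+1 * dcol K.+2 v + dcol K.+2 (fun c r => v (bump K.+1 c) r))
    + dcol K.+1 (fun c r => w (bump K c) r.+1) * dcol K.+2 v = 0.
Proof.
move=> d0.
have e0v : dcol2 K w (unitv F 0) (v 0%N) = dcol K.+1 (fun c r => v c r.+1).
  by rewrite dcol2_unitv_col0 // mul1r.
have nz : dcol2 K w (unitv F 0) (v 0%N) != 0 by rewrite e0v.
have := dcol2_pluecker (w K) (w K.+1) nz.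
rewrite e0v dcol2_last2 dcol2_col0_last !dcol2_unitv0 dcol2_col0.
rewrite (dcol_vrcons_id w S) (dcol_vrcons_bump w S).
rewrite (_ : dcol K.+2 (vrcons K.+1 w (w K.+1)) = dcol K.+2 w); last first.
  by apply: eq_dcol => c r lt_c _; rewrite /vrcons; case: ifP => // ?;
    congr (w _ _); lia.
(* Expanding w_{K+1} in its two summands is the origin of the isolated variable in [rC_next]. *)
rewrite (_ : dcol K.+2 (vrcons K.+1 v (w K.+1)) =
    y K.+1 * dcol K.+2 v + dcol K.+2 (fun c r => v (bump K.+1 c) r)).
  move: signM => ss; set s := (-1) ^+ K in ss * => E.
  by rewrite -E; ring: ss.
rewrite dcol_rconsD; congr (_ * _ + _); apply: eq_dcol => c r lt_c _.
  by rewrite /vrcons; case: ifP => // ?; congr (v _ _); lia.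
by rewrite /vrcons /bump; case: ifP => ?; congr (v _ _); lia.
Qed.

End NextLetter.

End MinorIdentities.

(** * Minors of the products of bidiagonal matrices *)

Section LetterProduct.
Variables (R : comNzRingType) (X : nat -> nat -> R).

(* The infinite lower triangular version of W(x_1) ... W(x_k): being lower
   triangular, it restricts to n x n matrices compatibly with products. *)
Fixpoint Mnat k a b : R :=
  if k is k'.+1 then X k' b * Mnat k' a b + Mnat k' a b.+1 else (a == b)%:R.

Arguments Mnat (k a b)%_N.

Lemma MnatS k a b : Mnat k.+1 a b = X k b * Mnat k a b + Mnat k a b.+1.
Proof. by []. Qed.

Lemma Mnat_upper k a b : (a < b)%N -> Mnat k a b = 0.
Proof.
elim: k b => [|k IH] b lt_ab /=; first by rewrite ltn_eqF.
by rewrite !IH ?mulr0 ?addr0 // ltnW.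
Qed.

Lemma Mnat_lower k a b : (b + k < a)%N -> Mnat k a b = 0.
Proof.
elim: k b => [|k IH] b lt_ba /=; first by rewrite gtn_eqF //; lia.
by rewrite !IH ?mulr0 ?addr0 //; lia.
Qed.

Lemma Mnat_corner k b : Mnat k (b + k) b = 1.
Proof.
elim: k b => [|k IH] b /=; first by rewrite addn0 eqxx.
by rewrite Mnat_lower ?mulr0 ?add0r -?addSnnS ?IH //; lia.
Qed.

(** Going from row b + k to column b in k + 1 letters means staying in place exactly once; if this
    happens at letter t, it happens in column b + k - t. *)
Lemma Mnat_subcorner k b :
  Mnat k.+1 (b + k) b = \sum_(0 <= t < k.+1) X t (b + k - t)%N.
Proof.
elim: k b => [|k IH] b.
  by rewrite big_nat1 /= addn0 subn0 eqxx mulr1 (_ : (b == b.+1) = false) ?addr0 //; lia.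
rewrite big_nat_recr // addnK MnatS Mnat_corner mulr1 addrC -addSnnS IH.
by rewrite addSnnS.
Qed.

(* [bump h i] skips the value [h]: the second minor omits the row a+1, and the
   third one the column N-1. *)
Definition Dmin k a N : R := dcol N (fun c r => Mnat k (a + r) c).
Definition Hmin k a N : R := dcol N (fun c r => Mnat k (a + bump 1 r) c).
Definition Cmin k a N : R := dcol N (fun c r => Mnat k (a + r) (bump N.-1 c)).

Arguments Dmin (k a N)%_N.
Arguments Hmin (k a N)%_N.
Arguments Cmin (k a N)%_N.

Lemma Dmin0 k a : Dmin k a 0 = 1. Proof. exact: det_mx00. Qed.

Lemma Dmin1 k a : Dmin k a 1 = Mnat k a 0.
Proof. by rewrite /Dmin /dcol det_mx11 mxE addn0. Qed.

Lemma DminS k a N : Dmin k a.+1 N = dcol N (fun c r => Mnat k (a + r.+1) c).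
Proof. by apply: eq_dcol => c r _ _; rewrite addSnnS. Qed.

Lemma DminSS k a N : Dmin k a.+2 N = dcol N (fun c r => Mnat k (a + r.+2) c).
Proof. by apply: eq_dcol => c r _ _; rewrite !addSnnS. Qed.

Lemma dcol_upper N (g : nat -> nat -> R) :
  (forall c r, (c < r < N)%N -> g c r = 0) ->
  dcol N g = \prod_(0 <= i < N) g i i.
Proof.
move=> g0; rewrite /dcol -det_tr det_trig.
  by rewrite big_mkord; apply: eq_bigr => i _; rewrite !mxE.
by apply/is_trig_mxP => i j lt_ij; rewrite !mxE g0 // lt_ij ltn_ord.
Qed.

(** The minor is triangular, with the 1s of the extreme subdiagonal on its diagonal. Together with
    the next two lemmas this provides the boundary values of the telescoping sums. *)
Lemma Dmin_corner k N : Dmin k k N = 1.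
Proof.
rewrite /Dmin dcol_upper => [|c r lt_cr].
  by rewrite big_nat big1 // => i _; rewrite addnC Mnat_corner.
by apply: Mnat_lower; lia.
Qed.

Lemma Hmin_corner k N : Hmin k.+1 k N.+1 = Mnat k.+1 k 0.
Proof.
rewrite /Hmin dcol_upper => [|c r lt_cr].
  rewrite big_nat_recl // addn0 big_nat big1 ?mulr1 // => i _.
  have -> : (k + bump 1 i.+1 = i.+1 + k.+1)%N by rewrite /bump; lia.
  exact: Mnat_corner.
by apply: Mnat_lower; rewrite /bump; lia.
Qed.

Lemma Cmin_corner k N : Cmin k k N.+1 = Mnat k (k + N) N.+1.
Proof.
rewrite /Cmin dcol_upper => [|c r lt_cr].
  rewrite big_nat_recr //= /bump leqnn big_nat big1 ?mul1r // => i lt_i.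
  by rewrite leqNgt; case/andP: lt_i => _ ->; rewrite add0n addnC Mnat_corner.
by apply: Mnat_lower; rewrite /bump; lia.
Qed.

End LetterProduct.

Arguments Mnat {R} X (k a b)%_N : simpl never.
Arguments Dmin {R} X (k a N)%_N.
Arguments Hmin {R} X (k a N)%_N.
Arguments Cmin {R} X (k a N)%_N.

(** * Recurrences for the ratios of minors *)

Section MinorRatios.
Variables (F : fieldType) (X : nat -> nat -> F).
Local Notation D := (Dmin X).

(* For N = 0 the minors are not meaningful and the conventional value 0 makes
   the recurrences below start correctly. *)
Definition rH k a N : F := if N is 0 then 0 else Hmin X k a N / D k a.+1 N.
Definition rC k a N : F := if N is 0 then 0 else Cmin X k a N / D k a N.

(** The right-hand sides of this and the next three lemmas are, in this order, z_{i,j} / z_{i+1,j+1}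
    and z_{i,j+1} / z_{i,j} (with a = i-1, N = j-i), then z'_{j,i} / z'_{j+1,i+1} (with k = i, a =
    j-1, N = n-j-1) and z'_{j,i+1} / z'_{j,i} (with k = i, a = j-1, N = n-j). *)
Lemma rH_step k a N : D k a.+1 N != 0 -> D k a.+1 N.+1 != 0 ->
  rH k a N.+1 - rH k a N =
  D k a N.+1 * D k a.+2 N / (D k a.+1 N * D k a.+1 N.+1).
Proof.
case: N => [|N] d0 d1.
  by rewrite /rH subr0 !Dmin0 mul1r mulr1 !Dmin1 /Hmin /dcol det_mx11 mxE addn0.
have := @minor_flag _ N.+1 (fun c r => Mnat X k (a + r) c) isT.
rewrite -DminS -!DminSS -DminS => /(_ d1) E.
rewrite /rH; apply/(mulIf (mulf_neq0 d0 d1)).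
rewrite -[RHS]mulrA mulVf ?mulf_neq0 // mulr1.
rewrite -[RHS]subr0 -E /Hmin /Dmin; field.
by rewrite -/(D k a.+1 N.+1) -/(D k a.+1 N.+2) d0.
Qed.

Lemma rC_step k a N : D k a N.+1 != 0 -> D k a.+1 N.+1 != 0 ->
  rC k a.+1 N.+1 - rC k a N.+1 =
  D k a N.+2 * D k a.+1 N / (D k a N.+1 * D k a.+1 N.+1).
Proof.
move=> d0 d1.
have := @minor_desnanot _ N (fun c r => Mnat X k (a + r) c).
rewrite -!DminS => /(_ d1) E.
apply/(mulIf (mulf_neq0 d0 d1)).
rewrite -[RHS]mulrA mulVf ?mulf_neq0 // mulr1.
rewrite -[RHS]subr0 -E /rC.
have -> : Cmin X k a.+1 N.+1 = dcol N.+1 (fun c r => Mnat X k (a + r.+1) (bump N c)).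
  by apply: eq_dcol => c r _ _; rewrite addSnnS.
by rewrite /Cmin /Dmin; field; rewrite -/(D k a.+1 N.+1) -/(D k a N.+1) d0.
Qed.

Lemma rH_next k a N : D k a.+1 N.+1 != 0 -> D k.+1 a.+1 N.+1 != 0 ->
  rH k a N.+1 - rH k.+1 a N.+1 =
  D k a N.+2 * D k.+1 a.+2 N / (D k a.+1 N.+1 * D k.+1 a.+1 N.+1).
Proof.
move=> d0 d1.
have := @minor_flag_next _ N (fun c r => Mnat X k (a + r) c) (X k).
rewrite -DminS => /(_ d0).
rewrite -(DminSS X k.+1) -(DminS X k.+1) => E.
apply/(mulIf (mulf_neq0 d0 d1)).
rewrite -[RHS]mulrA mulVf ?mulf_neq0 // mulr1 -[RHS]subr0 -E /rH.
by rewrite /Hmin /Dmin /=; field; apply/andP; split; [exact: d1 | exact: d0].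
Qed.

Lemma rC_next k a N : D k a N.+1 != 0 -> D k a.+1 N != 0 ->
    D k.+1 a.+1 N != 0 ->
  X k N - rC k.+1 a.+1 N + rC k a N.+1 =
  D k.+1 a N.+1 * D k a.+1 N / (D k.+1 a.+1 N * D k a N.+1).
Proof.
case: N => [|N] d2 d0 d1.
  move: d2; rewrite /rC subr0 !Dmin0 mul1r mulr1 !Dmin1 => d2.
  by rewrite /Cmin /dcol det_mx11 mxE addn0 MnatS mulrDl mulfK.
have := @minor_desnanot_next _ N (fun c r => Mnat X k (a + r) c) (X k).
rewrite -DminS => /(_ d0).
rewrite -(DminS X k.+1).
have -> : dcol N.+1 (fun c r => X k (bump N c) * Mnat X k (a + r.+1) (bump N c)
   + Mnat X k (a + r.+1) (bump N c).+1) = Cmin X k.+1 a.+1 N.+1.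
  by apply: eq_dcol => c r _ _; rewrite addSnnS.
move=> E; apply/(mulIf (mulf_neq0 d1 d2)).
rewrite -[RHS]mulrA mulVf ?mulf_neq0 // mulr1 -[RHS]subr0 -E /rC.
by rewrite /Cmin /Dmin /=; field; apply/andP; split; [exact: d2 | exact: d1].
Qed.

End MinorRatios.

(** * Telescoping of the decorations *)

(** For fixed k = j + 1 - i, the index i runs from 1 to min(I, n - k) and the terms telescope in
    i. *)
Lemma sum_telescope_diag (V : zmodType) (c : nat -> nat -> V) n I :
    (forall k, c 0%N k = 0) ->
  \sum_(1 <= i < I.+1) \sum_(i <= j < n)
     (c i (j.+1 - i)%N - c i.-1 (j.+1 - i)%N) =
  \sum_(1 <= k < n) c (minn I (n - k)) k.
Proof.
move=> c0; elim: I => [|I IH].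
  by rewrite big_geq // big1 // => k _; rewrite min0n.
rewrite big_nat_recr //= IH; apply/esym/eqP; rewrite addrC -subr_eq -sumrB.
apply/eqP; have [le_nI|lt_In] := leqP n I.
  rewrite [RHS]big_geq; last by lia.
  rewrite big_nat_cond big1 // => k lt_k; apply/eqP; rewrite subr_eq0; apply/eqP.
  by congr (c _ _); lia.
rewrite (@big_cat_nat _ _ _ (n - I)) //=; [|lia..].
rewrite [X in _ + X]big_nat_cond [X in _ + X]big1 ?addr0 => [|k lt_k]; last first.
  by apply/eqP; rewrite subr_eq0; apply/eqP; congr (c _ _); lia.
rewrite -[in RHS](add1n I) big_addn; apply: eq_big_nat => k lt_k.
have -> : ((k + I).+1 - I.+1 = k)%N by lia.
by congr (c _ _ - c _ _); lia.
Qed.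

(** The positive part of the term (i, j) cancels the negative part of (i+1, j+1). What survives has
    i = M - 1, apart from the values at 0 and n, which vanish. *)
Lemma sum_telescope_antidiag (V : zmodType) (q : nat -> nat -> V) n M :
    (forall i, q i 0%N = 0) -> (forall i, q i n = 0) ->
  \sum_(1 <= j < n.+1) \sum_(j <= i < M) (q i.+1 j - q i j.-1) =
  \sum_(1 <= j < n.+1 | (j < M)%N) q M j.
Proof.
move=> q0 qn; elim: M => [|M IH].
  rewrite big_nat_cond big1 => [|j lt_j]; last by rewrite big_geq.
  by rewrite big_pred0_eq.
have -> : \sum_(1 <= j < n.+1) \sum_(j <= i < M.+1) (q i.+1 j - q i j.-1) =
    \sum_(1 <= j < n.+1) \sum_(j <= i < M) (q i.+1 j - q i j.-1)
    + \sum_(1 <= j < n.+1 | (j < M.+1)%N) (q M.+1 j - q M j.-1).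
  rewrite [X in _ + X]big_mkcond -big_split; apply: eq_big_nat => j _ /=.
  case: ltnP => [le_jM|lt_Mj]; first by rewrite big_nat_recr.
  by rewrite !big_geq ?addr0 // ltnW.
rewrite IH sumrB addrCA [X in _ + X](_ : _ = 0) ?addr0 //.
apply/eqP; rewrite subr_eq0; apply/eqP.
rewrite [RHS]big_add1 /= [LHS]big_mkcond [RHS]big_mkcond /=.
transitivity (\sum_(0 <= j < n.+1) if (j < M)%N then q M j else 0).
  by rewrite [RHS]big_ltn // q0 if_same add0r.
by rewrite big_nat_recr //= qn if_same addr0.
Qed.

Section Decorations.
Variables (F : fieldType) (X : nat -> nat -> F) (m n : nat).
Local Notation D := (Dmin X).

Definition Pmin i j : F := D m i.-1 (j.+1 - i) / D m i (j - i).
Definition Qmin j i : F := D i j.-1 (n.+1 - j) / D i j (n - j).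

(** The last column of this minor is column N of a lower triangular matrix, restricted to rows above
    N. *)
Lemma rC_row0 k N : rC X k 0 N = 0.
Proof.
case: N => [//|N]; rewrite /rC /Cmin /dcol (expand_det_col _ ord_max).
rewrite big1 ?mul0r // => r _; rewrite mxE Mnat_upper ?mul0r //= /bump leqnn.
exact: ltn_ord.
Qed.

Hypothesis D_neq0 : forall k a N,
  (k <= m)%N -> (a <= k)%N -> (a + N <= n)%N -> D k a N != 0.

Lemma decorP_minors : (0 < m)%N ->
  decorP m n Pmin =
    \sum_(1 <= k < n) rC X m (minn m (n - k)) k
    + \sum_(1 <= i < m) rH X m i.-1 (n - i)
    + (if (m < n)%N then Mnat X m m.-1 0 else 0).
Proof.
move=> m_gt0; rewrite /decorP; congr (_ + _ + _); last first.
- case: ifP => // _.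
  by rewrite /Pmin subSnn subnn Dmin0 divr1 Dmin1.
- apply: eq_big_nat => i /andP[i_gt0 lt_im].
  have [le_ni|lt_in] := leqP n i.
    by rewrite big_geq // (_ : n - i = 0)%N //; lia.
  transitivity (rH X m i.-1 (n - i) - rH X m i.-1 (i - i)); last first.
    by rewrite subnn subr0.
  rewrite -(telescope_sumr (fun j => rH X m i.-1 (j - i))); last exact: ltnW.
  apply: eq_big_nat => j /andP[le_ij lt_jn].
  rewrite subSn // rH_step ?D_neq0 //; [|lia..].
  case: i i_gt0 lt_im lt_in le_ij => [//|a] _ lt_im lt_in le_ij.
  by rewrite /Pmin !subSS invf_div mulf_div -(subnSK le_ij).
- rewrite -(@sum_telescope_diag _ (rC X m)) => [|k]; last exact: rC_row0.
  apply: eq_big_nat => -[//|a] /= lt_am; apply: eq_big_nat => j /andP[lt_aj lt_jn].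
  rewrite [(j.+1 - _)%N]subSS -(subnSK lt_aj) rC_step ?D_neq0 //; [|lia..].
  rewrite /Pmin !subSS invf_div mulf_div [X in _ / X]mulrC -(subnSK lt_aj).
  by have -> : (j.+1 - a = (j - a.+1).+2)%N by lia.
Qed.

Lemma decorQ_minors : (0 < n)%N ->
  decorQ m n Qmin =
    \sum_(1 <= j < n.+1 | (j < m)%N)
       (Mnat X j j.-1 0 - rH X m j.-1 (n - j) - rC X m j (n - j))
    + \sum_(1 <= j < n.+1) \sum_(j <= i < m) X i (n - j)%N.
Proof.
move=> n_gt0; rewrite /decorQ.
have -> : \sum_(1 <= j < n) \sum_(j <= i < m) Qmin j i / Qmin j.+1 i.+1 =
    \sum_(1 <= j < n | (j < m)%N) (Mnat X j j.-1 0 - rH X m j.-1 (n - j)).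
  rewrite [RHS]big_mkcond; apply: eq_big_nat => -[//|a] /= lt_an.
  case: ltnP => [lt_am|le_ma]; last by rewrite big_geq.
  have -> : (n - a.+1)%N = (n - a.+2).+1 by lia.
  set N := (n - a.+2)%N.
  (* The entry is the value of [rH] at the first letter count i = j of the telescoping sum. *)
  have -> : Mnat X a.+1 a 0 = rH X a.+1 a N.+1.
    by rewrite /rH Hmin_corner Dmin_corner divr1.
  rewrite -[RHS]opprB -(telescope_sumr (fun i => rH X i a N.+1)) ?(ltnW lt_am) //.
  rewrite -sumrN; apply: eq_big_nat => i lt_i.
  rewrite opprB rH_next ?D_neq0 //; try lia.
  rewrite /Qmin /= !subSS (_ : (n - a = N.+2)%N) 1?(_ : (n - a.+1 = N.+1)%N); try lia.
  by rewrite invf_div mulf_div -/N.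
have -> : \sum_(1 <= j < n.+1) \sum_(j <= i < m) Qmin j i.+1 / Qmin j i =
    \sum_(1 <= j < n.+1) \sum_(j <= i < m) X i (n - j)%N
    - \sum_(1 <= j < n.+1 | (j < m)%N) rC X m j (n - j).
  rewrite -(sum_telescope_antidiag (q := fun i j => rC X i j (n - j))) => [|i|i].
  - rewrite -sumrB; apply: eq_big_nat => -[//|a] lt_Sa /=.
    have lt_an : (a < n)%N by lia.
    rewrite -sumrB; apply: eq_big_nat => i lt_i.
    rewrite opprB addrA addrAC -(subnSK lt_an) rC_next ?D_neq0 //; try lia.
    by rewrite /Qmin subSS invf_div mulf_div -(subnSK lt_an).
  - by rewrite subn0 rC_row0.
  - by rewrite subnn.
rewrite [in RHS]sumrB -addrA.
(* The extra term z'_{n,n} is exactly the missing summand j = n, because [rH] is 0 by convention at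
   N = 0. *)
have -> : \sum_(1 <= j < n | (j < m)%N) (Mnat X j j.-1 0 - rH X m j.-1 (n - j))
      + (if (n < m)%N then Qmin n n else 0) =
    \sum_(1 <= j < n.+1 | (j < m)%N) (Mnat X j j.-1 0 - rH X m j.-1 (n - j)).
  rewrite [X in X + _]big_mkcond [RHS]big_mkcond big_nat_recr //=.
  by rewrite subnn subr0 /Qmin subSnn subnn Dmin0 divr1 Dmin1.
by rewrite addrC addrA addrAC.
Qed.
End Decorations.

(** * Nonintersecting paths and tableaux *)

Definition ffun_ext (A : finType) (a : A) k (E : {ffun 'I_k -> A}) (t : nat) : A :=
  if insub t is Some o then E o else a.

Lemma sum_ffun_recr (V : nmodType) (A : finType) (a0 : A) k (G : (nat -> A) -> V) :
  \sum_(E : {ffun 'I_k.+1 -> A}) G (ffun_ext a0 E) =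
  \sum_(a : A) \sum_(E : {ffun 'I_k -> A})
    G (fun t => if t == k then a else ffun_ext a0 E t).
Proof.
rewrite pair_big /=.
pose h (p : A * {ffun 'I_k -> A}) : {ffun 'I_k.+1 -> A} :=
  [ffun t => if unlift ord_max t is Some t' then p.2 t' else p.1].
rewrite (reindex h) /=; last first.
  exists (fun E : {ffun 'I_k.+1 -> A} =>
           (E ord_max, [ffun t => E (lift ord_max t)])) => [[a E] _|E _].
    rewrite /h /= ffunE unlift_none; congr (_, _).
    by apply/ffunP => t; rewrite !ffunE liftK.
  by apply/ffunP => t; rewrite ffunE; case: unliftP => [j ->|->]; rewrite ?ffunE.
apply: eq_bigr => -[a E] _; congr (G _); apply/funext => t /=.
rewrite /ffun_ext /h; case: insubP => [o lt_tk ot|ge_tk].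
  rewrite ffunE; case: unliftP => [j oE|oE]; last first.
    by rewrite -ot oE /= eqxx.
  have tj : t = j by rewrite -ot oE /= /bump leqNgt ltn_ord.
  by rewrite tj ltn_eqF // valK.
rewrite gtn_eqF; last by lia.
by rewrite insubN //; lia.
Qed.

Lemma incr_ord_ge N (f : 'I_N -> 'I_N) :
  (forall l l' : 'I_N, (l < l')%N -> (f l < f l')%N) -> forall l : 'I_N, (l <= f l)%N.
Proof.
move=> f_incr [l lt_l] /=; elim: l lt_l => [//|l IH] lt_l.
have lt_l' : (l < N)%N by lia.
exact: leq_ltn_trans (IH lt_l') (f_incr (Ordinal lt_l') (Ordinal lt_l) (ltnSn l)).
Qed.

(** [incr_ord_ge] is applied to f and to its conjugate by [rev_ord], which gives both
    inequalities. *)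
Lemma incr_ord_id N (f : 'I_N -> 'I_N) :
  (forall l l' : 'I_N, (l < l')%N -> (f l < f l')%N) -> f =1 id.
Proof.
move=> f_incr l; apply/val_inj/eqP; rewrite eqn_leq (incr_ord_ge f_incr) andbT.
have := @incr_ord_ge N (fun l => rev_ord (f (rev_ord l))).
move=> /(_ _ (rev_ord l)) /=; rewrite rev_ordK => H.
have : (N - l.+1 <= N - (f l).+1)%N.
  apply: H => l1 l2 lt12; have := f_incr (rev_ord l2) (rev_ord l1).
  have := ltn_ord (f (rev_ord l1)); have := ltn_ord (f (rev_ord l2)).
  by move=> /=; have := ltn_ord l1; have := ltn_ord l2; lia.
by have := ltn_ord l; have := ltn_ord (f l); lia.
Qed.

Section Paths.
Variables (R : comNzRingType) (X : nat -> nat -> R) (N : nat) (i : 'I_N -> nat).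
Implicit Types (c : 'I_N -> nat) (e : {set 'I_N}) (E : nat -> {set 'I_N}).

Definition incr c := [forall l : 'I_N, forall l' : 'I_N, (l < l')%N ==> (c l < c l')%N].

Lemma incrP c : reflect (forall l l' : 'I_N, (l < l')%N -> (c l < c l')%N) (incr c).
Proof.
apply: (iffP forallP) => [H l l'|H l].
  by have /forallP/(_ l')/implyP := H l.
by apply/forallP => l'; apply/implyP; apply: H.
Qed.

Definition path_det k c : R := \det (\matrix_(l, l') Mnat X k (i l) (c l')).

(* The paths in [e] pick up a variable at the current letter and stay in place,
   the other ones move. *)
Definition pstep e c l : nat := (c l + (l \notin e))%N.

Lemma path_det_perm k c :
  path_det k c = \sum_(s : 'S_N) (-1) ^+ s * \prod_l Mnat X k (i (s l)) (c l).
Proof.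
rewrite /path_det -det_tr; apply: eq_bigr => s _; congr (_ * _).
by apply: eq_bigr => l _; rewrite !mxE.
Qed.

(** Multilinearity: every column of M_{k+1} is a sum of two terms, and [e] records the columns in
    which the term with the variable is chosen. *)
Lemma path_det_recr k c :
  path_det k.+1 c = \sum_(e : {set 'I_N}) (\prod_(l in e) X k (c l)) * path_det k (pstep e c).
Proof.
rewrite path_det_perm; under [RHS]eq_bigr do rewrite path_det_perm big_distrr.
rewrite [RHS]exchange_big; apply: eq_bigr => s _ /=.
under eq_bigr do rewrite MnatS.
rewrite bigA_distr big_distrr; apply: eq_bigr => e _ /=.
rewrite [RHS]mulrCA; congr (_ * _).
rewrite [X in _ = X * _]big_mkcond -big_split; apply: eq_bigr => l _ /=.
rewrite /pstep; case: ifP => _; first by rewrite addn0.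
by rewrite mul1r addn1.
Qed.

(* Two paths can only cross by meeting, because each moves by at most one step;
   when they meet, the determinant has two equal columns.  Hence no sign
   reversing involution is needed. *)
Lemma path_det_collision k c e : incr c -> ~~ incr (pstep e c) -> path_det k (pstep e c) = 0.
Proof.
move=> /incrP c_incr; rewrite negb_forall => /existsP[l].
rewrite negb_forall => /existsP[l']; rewrite negb_imply -leqNgt => /andP[lt_ll' le_cc].
have eq_c : pstep e c l = pstep e c l'.
  by move: (c_incr _ _ lt_ll') le_cc; rewrite /pstep; case: (l \in e); case: (l' \in e) => /=; lia.
rewrite /path_det -det_tr; apply: (determinant_alternate (i1 := l) (i2 := l')).
  by rewrite -val_eqE /= ltn_eqF.
by move=> j; rewrite !mxE eq_c.
Qed.

(** Letters are read backwards, from the end columns [c] to the starting rows [i]; a family that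
    stops being strictly ordered gets weight 0. *)
Fixpoint pathw k c E : R :=
  if k is k'.+1 then
    (\prod_(l in E k') X k' (c l)) *
    (if incr (pstep (E k') c) then pathw k' (pstep (E k') c) E else 0)
  else [forall l : 'I_N, c l == i l]%:R.

Lemma eq_pathw k c E E' : (forall t, (t < k)%N -> E t = E' t) ->
  pathw k c E = pathw k c E'.
Proof.
elim: k c => [//|k IH] c eqE /=; rewrite eqE // IH // => t lt_tk.
by rewrite eqE // ltnW.
Qed.

Lemma path_det0 c : incr i -> incr c -> path_det 0 c = [forall l : 'I_N, c l == i l]%:R.
Proof.
move=> /incrP i_incr /incrP c_incr; case: forallP => [c_i|nc_i].
  rewrite /path_det -[RHS](det1 R N); congr (\det _); apply/matrixP => l l'.
  rewrite !mxE /= (eqP (c_i l')); congr (_ %:R); congr nat_of_bool.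
  apply/eqP/eqP => [eq_i|-> //]; apply/val_inj; move: eq_i.
  by case: (ltngtP l l') => // /i_incr; lia.
(* Otherwise i = c o f with f strictly increasing, hence f is the identity and i = c. A row index
   missing from [c] gives a zero row. *)
have [l nl] : exists l, forall l', i l <> c l'.
  apply: contrapT => /forallNP all_m; apply: nc_i => l.
  have /boolp.choice[f f_m] : forall k, exists l', i k = c l'.
    by move=> k; apply: contrapT => /forallNP; apply: all_m.
  rewrite f_m (incr_ord_id (f := f)) // => l1 l2 /i_incr; rewrite !f_m.
  case: (ltngtP (f l1) (f l2)) => // [/c_incr|/val_inj ->]; lia.
rewrite /path_det (expand_det_row _ l) big1 // => l' _.
by rewrite mxE /Mnat; case: eqP => [/nl//|_]; rewrite mul0r.
Qed.

Lemma path_det_paths k c : incr i -> incr c ->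
  path_det k c = \sum_(E : {ffun 'I_k -> {set 'I_N}}) pathw k c (ffun_ext set0 E).
Proof.
move=> i_incr; elim: k c => [|k IH] c c_incr.
  rewrite path_det0 //= (big_pred1 [ffun=> set0]) // => E /=.
  by apply/esym/eqP/ffunP => -[].
rewrite path_det_recr (sum_ffun_recr set0 k (pathw k.+1 c)); apply: eq_bigr => e _.
rewrite /= eqxx -big_distrr /=; congr (_ * _).
have [c'_incr|c'_incr] := boolP (incr (pstep e c)); last first.
  by rewrite path_det_collision // big1.
rewrite IH //; apply: eq_bigr => E _; apply: eq_pathw => t lt_tk.
by rewrite ltn_eqF.
Qed.

Definition cnt E t l := (\sum_(0 <= s < t) (l \in E s))%N.

Definition path_ok k c E :=
  [forall l, (c l + k == i l + cnt E k l)%N] &&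
  all (fun t => incr (fun l => i l + cnt E t l)%N) (iota 0 k).

(** Forward description: each letter lowers the column by one unless the path picks up a variable,
    so before letter t path l stands in column i l + cnt E t l - t. The common shift by t is dropped
    in the order test of [path_ok]. *)
Lemma pathwE k c E : pathw k c E =
  if path_ok k c E then
    \prod_(0 <= t < k) \prod_(l in E t) X t (i l + cnt E t l - t)%N
  else 0.
Proof.
elim: k c => [|k IH] c.
  rewrite /= /path_ok andbT big_geq //.
  rewrite (eq_forallb (P2 := fun l => c l == i l)); first by case: ifP.
  by move=> l; rewrite /cnt big_geq // !addn0.
rewrite /= IH {IH}.
have cntS l : cnt E k.+1 l = (cnt E k l + (l \in E k))%N by rewrite /cnt big_nat_recr.
have okS : path_ok k.+1 c E = path_ok k (pstep (E k) c) E &&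
    incr (fun l => i l + cnt E k l)%N.
  rewrite /path_ok -addn1 iotaD all_cat /= andbT andbA addn1; congr (_ && _ && _).
  apply: eq_forallb => l; rewrite cntS /pstep.
  by case: (l \in E k) => /=; lia.
rewrite okS; have [okk|_] := boolP (path_ok k _ E); last first.
  by rewrite if_same mulr0.
have cE l : (pstep (E k) c l + k = i l + cnt E k l)%N.
  by case/andP: okk => /forallP/(_ l)/eqP.
have -> : incr (pstep (E k) c) = incr (fun l => i l + cnt E k l)%N.
  apply: eq_forallb => l; apply: eq_forallb => l'.
  by congr (_ ==> _); rewrite -!cE ltn_add2r.
rewrite /=; case: ifP => _; last by rewrite mulr0.
rewrite big_nat_recr //= mulrC; congr (_ * _); apply: eq_bigr => l l_E.
by rewrite -cE addnK /pstep l_E addn0.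
Qed.

End Paths.

(** * From path families to semistandard tableaux *)

Definition tableau (C : finType) m (row col : C -> nat) (T : {ffun C -> 'I_m}) :=
  [forall s, forall t,
     ((row s == row t) && (col s <= col t)%N ==> (T s <= T t)%N)
  && ((col s == col t) && (row s < row t)%N ==> (T s < T t)%N)].

Lemma tableauP (C : finType) m (row col : C -> nat) (T : {ffun C -> 'I_m}) :
  reflect
    ((forall s t, row s = row t -> (col s <= col t)%N -> (T s <= T t)%N) /\
     (forall s t, col s = col t -> (row s < row t)%N -> (T s < T t)%N))
    (tableau row col T).
Proof.
apply: (iffP forallP) => [H|[H1 H2] s].
  split=> s t; have /forallP/(_ t)/andP[/implyP h1 /implyP h2] := H s.
    by move=> /eqP e1 e2; apply: h1; rewrite e1.
  by move=> /eqP e1 e2; apply: h2; rewrite e1.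
apply/forallP => t; apply/andP; split; apply/implyP => /andP[/eqP].
  exact: H1.
exact: H2.
Qed.

Section Counts.
Variable N : nat.
Implicit Types (E : nat -> {set 'I_N}) (l : 'I_N).

Lemma cntS E t l : cnt E t.+1 l = (cnt E t l + (l \in E t))%N.
Proof. by rewrite /cnt big_nat_recr. Qed.

Lemma cnt0 E l : cnt E 0 l = 0%N.
Proof. by rewrite /cnt big_geq. Qed.

Lemma leq_cnt E t t' l : (t <= t')%N -> (cnt E t l <= cnt E t' l)%N.
Proof.
move=> /subnK <-; elim: (_ - _)%N => [//|d IH].
by rewrite addSn cntS (leq_trans IH) ?leq_addr.
Qed.

Lemma cnt_jump E t l r : (r < cnt E t l)%N ->
  exists2 t', (t' < t)%N & l \in E t' /\ cnt E t' l = r.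
Proof.
elim: t => [|t IH]; first by rewrite cnt0.
rewrite cntS; have [/IH[t' lt_t' t'P] _|le_r] := ltnP r (cnt E t l).
  by exists t' => //; apply: ltnW.
case: (boolP (l \in E t)) => [l_t|_]; last by lia.
by exists t => //; split=> //; lia.
Qed.

Lemma cnt_jump_inj E t t' l : l \in E t -> l \in E t' ->
  cnt E t l = cnt E t' l -> t = t'.
Proof.
move=> lt lt' eq_c; case: (ltngtP t t') => // /(leq_cnt E l);
  by rewrite cntS ?lt ?lt'; lia.
Qed.

(** The starting points are spaced by l, so strict order of the paths becomes weak order of [u];
    this is the source of weakly increasing rows. *)
Lemma incr_gap e (u : 'I_N -> nat) : incr (fun l => e + l + u l)%N ->
  forall l l' : 'I_N, (l <= l')%N -> (u l <= u l')%N.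
Proof.
move=> /incrP u_incr l [l' lt_l'] /=; elim: l' lt_l' => [|l' IH] lt_l' le_l.
  by rewrite (_ : l = Ordinal lt_l') //; apply: val_inj => /=; lia.
have [eq_l|lt_l] := eqVneq (l : nat) l'.+1.
  by rewrite (_ : l = Ordinal lt_l') //; apply: val_inj.
have lt_l'' : (l' < N)%N by lia.
apply: leq_trans (IH lt_l'' _) _; first by lia.
by have := u_incr (Ordinal lt_l'') (Ordinal lt_l') (ltnSn l') => /=; lia.
Qed.

End Counts.

(* The cells of column number N-1-l form the path l: they occupy the rows
   [lo l, hi l), and the path l picks up x_t exactly when t is one of their
   entries. *)
Section TableauPaths.
Variables (R : comNzRingType) (X : nat -> nat -> R) (N m : nat) (t0 : 'I_m).
Variables (C : finType) (row col : C -> nat) (pth : C -> 'I_N).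
Variables (e : nat) (lo hi c : 'I_N -> nat).
Hypothesis col_path : forall s t, (col s <= col t)%N = (pth t <= pth s)%N.
Hypothesis cell_inj : forall s t, pth s = pth t -> row s = row t -> s = t.
Hypothesis cell_range : forall s, (lo (pth s) <= row s < hi (pth s))%N.
Hypothesis cell_ex : forall l a, (lo l <= a < hi l)%N ->
  exists2 s, pth s = l & row s = a.
Hypothesis lo_homo : forall l l' : 'I_N, (l <= l')%N -> (lo l <= lo l')%N.
Hypothesis hi_homo : forall l l' : 'I_N, (l <= l')%N -> (hi l <= hi l')%N.
Hypothesis le_lo_hi : forall l, (lo l <= hi l)%N.
Hypothesis cE : forall l, (c l + m = e + l + hi l)%N.

Let i (l : 'I_N) : nat := (e + l + lo l)%N.
Let ok (E : {ffun 'I_m -> {set 'I_N}}) := path_ok i m c (ffun_ext set0 E).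

Let extE (E : {ffun 'I_m -> {set 'I_N}}) (t : 'I_m) : ffun_ext set0 E t = E t.
Proof. by rewrite /ffun_ext valK. Qed.

Let col_pathE s t : (col s == col t) = (pth s == pth t).
Proof. by rewrite eqn_leq !col_path -eqn_leq eq_sym. Qed.

Let paths_of (T : {ffun C -> 'I_m}) : {ffun 'I_m -> {set 'I_N}} :=
  [ffun t => pth @: [set s | T s == t]].

(** The cell of path l in row lo l + r receives the letter at which the path picks up its variable
    number r, counted from 0. For admissible families such a letter exists and the default [t0] is
    not reached. *)
Let tableau_of (E : {ffun 'I_m -> {set 'I_N}}) : {ffun C -> 'I_m} :=
  [ffun s => odflt t0 [pick t : 'I_m | (pth s \in E t) &&
     (lo (pth s) + cnt (ffun_ext set0 E) t (pth s) == row s)%N]].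

Let tableau_ofE (E : {ffun 'I_m -> {set 'I_N}}) s (t : 'I_m) : pth s \in E t ->
  (lo (pth s) + cnt (ffun_ext set0 E) t (pth s))%N = row s ->
  tableau_of E s = t.
Proof.
move=> st ct; rewrite ffunE; case: pickP => [t' /andP[st' /eqP ct']|/(_ t)] /=.
  apply/val_inj/(@cnt_jump_inj _ (ffun_ext set0 E) _ _ (pth s)); rewrite ?extE //.
  by move: ct'; rewrite -ct => /addnI.
by rewrite st ct eqxx.
Qed.

Section FromPaths.
Variable E : {ffun 'I_m -> {set 'I_N}}.
Hypothesis okE : ok E.
Local Notation U t l := (lo l + cnt (ffun_ext set0 E) t l)%N.

Let U_total l : U m l = hi l.
Proof.
case/andP: okE => /forallP/(_ l)/eqP; rewrite cE /i => E1 _; lia.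
Qed.

Let U_homo t (l l' : 'I_N) : (t <= m)%N -> (l <= l')%N -> (U t l <= U t l')%N.
Proof.
rewrite leq_eqVlt => /predU1P[->|lt_tm]; first by rewrite !U_total; apply: hi_homo.
case/andP: okE => _ /allP/(_ t); rewrite mem_iota add0n lt_tm => /(_ isT).
rewrite /i => H; apply: (@incr_gap _ e (fun l => U t l)).
by congr (is_true _): H; apply: eq_forallb => k; apply: eq_forallb => k';
  rewrite !addnA.
Qed.

Let tableau_of_spec s : pth s \in E (tableau_of E s) /\
  U (tableau_of E s) (pth s) = row s.
Proof.
have := cell_range s; rewrite -U_total => /andP[le_lo lt_U].
have [|t lt_tm [st ct]] := @cnt_jump _ (ffun_ext set0 E) m (pth s) (row s - lo (pth s)).
  by lia.
rewrite (@tableau_ofE E s (Ordinal lt_tm)).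
- by rewrite -extE; split=> //=; lia.
- by rewrite -extE.
- by rewrite /=; lia.
Qed.

(** In the column of path l, [U t l] is the boundary between the entries smaller than t and the
    others. Monotonicity of U in l is then the row condition. *)
Let tableau_of_lt s t : (tableau_of E s < t)%N = (row s < U t (pth s))%N.
Proof.
have [st ct] := tableau_of_spec s; apply/idP/idP => [|].
  move=> /(leq_cnt (ffun_ext set0 E) (pth s)); rewrite cntS extE st; lia.
by apply: contraTT; rewrite -!leqNgt => /(leq_cnt (ffun_ext set0 E) (pth s)); lia.
Qed.

Lemma tableau_of_tableau : tableau row col (tableau_of E).
Proof.
apply/tableauP; split=> s t.
  move=> rst; rewrite col_path => /(U_homo (ltn_ord (tableau_of E t))) le_U.
  rewrite -ltnS tableau_of_lt rst; apply: leq_trans le_U.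
  by rewrite -tableau_of_lt.
move=> /eqP; rewrite col_pathE => /eqP pst lt_row; rewrite ltnNge.
apply/negP => /(leq_cnt (ffun_ext set0 E) (pth t)).
by have := (tableau_of_spec s).2; have := (tableau_of_spec t).2; rewrite pst; lia.
Qed.

Lemma tableau_ofK : paths_of (tableau_of E) = E.
Proof.
apply/ffunP => t; rewrite ffunE; apply/setP => l; apply/imsetP/idP => [[s]|l_t].
  by rewrite inE => /eqP <- ->; have [] := tableau_of_spec s.
have [s ps rs] : exists2 s, pth s = l & row s = U t l.
  apply: cell_ex; rewrite leq_addr /= -U_total ltn_add2l.
  have := leq_cnt (ffun_ext set0 E) l (ltn_ord t).
  by rewrite cntS extE l_t addn1.
exists s; last by rewrite ps.
rewrite inE; apply/eqP/tableau_ofE; by rewrite ps ?rs.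
Qed.

End FromPaths.

Section FromTableau.
Variable T : {ffun C -> 'I_m}.
Hypothesis tabT : tableau row col T.
Let E := paths_of T.
Local Notation U t l := (lo l + cnt (ffun_ext set0 E) t l)%N.

Let T_row s t : row s = row t -> (pth t <= pth s)%N -> (T s <= T t)%N.
Proof. by rewrite -col_path; apply: (tableauP _ _ _ tabT).1. Qed.

Let T_col s t : pth s = pth t -> (row s < row t)%N -> (T s < T t)%N.
Proof.
move=> /eqP; rewrite -col_pathE => /eqP.
exact: (tableauP _ _ _ tabT).2.
Qed.

Let paths_of_lt t : (t <= m)%N -> forall l, (U t l <= hi l)%N /\
  forall s, pth s = l -> (T s < t)%N = (row s < U t l)%N.
Proof.
elim: t => [|t IH] lt_tm l.
  rewrite cnt0 addn0; split=> // s ps.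
  by have := cell_range s; rewrite ps ltn0; lia.
have [le_U ltU] := IH (ltnW lt_tm) l.
rewrite cntS addnA (extE E (Ordinal lt_tm)) ffunE.
case: imsetP => [[s0]|nl] /=.
  rewrite inE => /eqP Ts0 ps0.
  have rs0 : row s0 = U t l.
    apply/eqP; rewrite eqn_leq; apply/andP.
    split; rewrite leqNgt; last by rewrite -ltU // Ts0 ltnn.
    apply/negP => lt_row.
    have [s1 ps1 rs1] : exists2 s, pth s = l & row s = U t l.
      apply: cell_ex; rewrite leq_addr /=.
      by have := cell_range s0; rewrite -ps0; lia.
    have := ltU s1 ps1; rewrite rs1 ltnn.
    have /T_col : pth s1 = pth s0 by rewrite ps1.
    by rewrite rs1 Ts0 => /(_ lt_row) ->.
  split=> [|s ps]; first by have := cell_range s0; rewrite -ps0; lia.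
  rewrite addn1 ltnS leq_eqVlt [RHS]leq_eqVlt eqSS ltnS -(ltU s ps); congr (_ || _).
  apply/eqP/eqP => [Ts|rs].
    have [lt_r|lt_r|-> //] := ltngtP (row s) (row s0).
      by have := @T_col s s0; rewrite ps Ts Ts0 /= ltnn => /(_ ps0 lt_r).
    by have := @T_col s0 s; rewrite ps Ts Ts0 /= ltnn => /(_ (esym ps0) lt_r).
  by rewrite (_ : s = s0) ?Ts0 //; apply: cell_inj; rewrite ?ps // rs rs0.
rewrite addn0; split=> // s ps; rewrite ltnS leq_eqVlt (ltU s ps).
case: eqP => //= Ts; case: nl; exists s => //; rewrite inE.
by apply/eqP/val_inj.
Qed.

Let paths_of_row s : U (T s) (pth s) = row s.
Proof.
have [_ ltU] := paths_of_lt (ltnW (ltn_ord (T s))) (pth s).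
have [_ ltU'] := paths_of_lt (ltn_ord (T s)) (pth s).
have := ltU s erefl; have := ltU' s erefl; rewrite ltnn ltnSn cntS.
by case: (_ \in _) => /=; lia.
Qed.

Lemma paths_of_ok : ok E.
Proof.
apply/andP; split.
  apply/forallP => l; rewrite cE /i -!addnA; apply/eqP; congr (_ + (_ + _))%N.
  have [le_U ltU] := paths_of_lt (leqnn m) l.
  apply/eqP; rewrite eqn_leq le_U andbT leqNgt; apply/negP => lt_U.
  have [s ps rs] := cell_ex (introT andP (conj (leq_addr _ _) lt_U)).
  by have := ltU s ps; rewrite rs ltnn ltn_ord.
apply/allP => t; rewrite mem_iota add0n => /= lt_tm.
apply/incrP => l l' lt_ll'; rewrite /i -!addnA ltn_add2l -addSn leq_add //.
rewrite leqNgt; apply/negP => lt_U.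
have [le_U ltU] := paths_of_lt (ltnW lt_tm) l.
have [le_U' ltU'] := paths_of_lt (ltnW lt_tm) l'.
(* If the paths were out of order, row U t l' would have an entry smaller than t in column l and an
   entry at least t in column l', which lies further left. *)
have [s ps rs] : exists2 s, pth s = l & row s = U t l'.
  by apply: cell_ex; have := lo_homo (ltnW lt_ll'); lia.
have [s' ps' rs'] : exists2 s, pth s = l' & row s = U t l'.
  by apply: cell_ex; have := hi_homo (ltnW lt_ll'); lia.
have := ltU' s' ps'; rewrite rs' ltnn => /negbT /negP[].
apply: leq_ltn_trans (_ : (T s < t)%N); last by rewrite (ltU s ps) rs.
by apply: T_row; rewrite ?rs ?rs' // ps ps' ltnW.
Qed.

Lemma paths_ofK : tableau_of E = T.
Proof.
apply/ffunP => s; apply: tableau_ofE; last exact: paths_of_row.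
by rewrite ffunE; apply/imsetP; exists s => //; rewrite inE.
Qed.

Lemma paths_of_weight :
  \prod_(0 <= t < m) \prod_(l in ffun_ext set0 E t)
     X t (i l + cnt (ffun_ext set0 E) t l - t)%N =
  \prod_s X (T s) (e + pth s + row s - T s)%N.
Proof.
rewrite big_mkord [RHS](partition_big T xpredT) //=; apply: eq_bigr => t _.
rewrite extE ffunE big_imset /=; last first.
  move=> s s'; rewrite !inE => /eqP Ts /eqP Ts' ps.
  by apply: cell_inj => //; rewrite -!paths_of_row ps Ts Ts'.
rewrite big_mkcond [RHS]big_mkcond; apply: eq_bigr => s _; rewrite inE.
by case: eqP => // <-; rewrite /i -!addnA paths_of_row.
Qed.

End FromTableau.

(** The Lindstroem-Gessel-Viennot lemma for these paths. The profiles [lo] and [hi] leave room for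
    rectangles with one added corner cell. *)
Lemma det_tableaux :
  \det (\matrix_(l < N, l' < N) Mnat X m (e + l + lo l) (c l')) =
  \sum_(T : {ffun C -> 'I_m} | tableau row col T)
    \prod_s X (T s) (e + pth s + row s - T s)%N.
Proof.
rewrite -[LHS]/(path_det X i m c) path_det_paths.
- under eq_bigr do rewrite pathwE.
  rewrite -big_mkcond (reindex_onto paths_of tableau_of) /=; last first.
    by move=> E okE; apply: tableau_ofK.
  apply: eq_big => [T|T /andP[okT /eqP TK]].
    apply/andP/idP => [[okT /eqP <-]|tabT]; first exact: tableau_of_tableau.
    by split; [exact: paths_of_ok|apply/eqP; exact: paths_ofK].
  by apply: paths_of_weight; rewrite -TK; apply: tableau_of_tableau.
- apply/incrP => l l' lt_ll'; have := lo_homo (ltnW lt_ll').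
  by rewrite /i; lia.
- apply/incrP => l l' lt_ll'; have := hi_homo (ltnW lt_ll').
  by have := cE l; have := cE l'; lia.
Qed.

End TableauPaths.

Definition fcons (A I : finType) (c : I) (T : {ffun A -> I}) : {ffun option A -> I} :=
  [ffun o => if o is Some s then T s else c].

Lemma sum_ffun_option (V : nmodType) (A I : finType)
    (P : pred {ffun option A -> I}) (G : {ffun option A -> I} -> V) :
  \sum_(T | P T) G T =
  \sum_(T : {ffun A -> I}) \sum_(c | P (fcons c T)) G (fcons c T).
Proof.
rewrite pair_big_dep /= (reindex (fun p : {ffun A -> I} * I => fcons p.2 p.1)) //=.
exists (fun T : {ffun option A -> I} => ([ffun s => T (Some s)], T None)).
  move=> [T c] _; rewrite /= ffunE; congr (_, _).
  by apply/ffunP => s; rewrite !ffunE.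
by move=> T _; apply/ffunP => -[s|]; rewrite !ffunE.
Qed.

Definition fsum (A B I : finType) (T : {ffun A -> I}) (T' : {ffun B -> I}) :
  {ffun A + B -> I} := [ffun o => match o with inl s => T s | inr t => T' t end].

Lemma sum_ffun_sum (V : nmodType) (A B I : finType) (G : {ffun A + B -> I} -> V) :
  \sum_T G T = \sum_(T : {ffun A -> I}) \sum_(T' : {ffun B -> I}) G (fsum T T').
Proof.
rewrite pair_big /=.
rewrite (reindex (fun p : {ffun A -> I} * {ffun B -> I} => fsum p.1 p.2)) //=.
exists (fun T : {ffun A + B -> I} => ([ffun s => T (inl s)], [ffun s => T (inr s)])).
  by move=> [T T'] _; congr (_, _); apply/ffunP => s; rewrite !ffunE.
by move=> T _; apply/ffunP => -[s|s]; rewrite !ffunE.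
Qed.

Lemma prod_option (R : comNzRingType) (A : finType) (f : option A -> R) :
  \prod_o f o = (\prod_s f (Some s)) * f None.
Proof.
rewrite (bigD1 None) //= mulrC; congr (_ * _).
rewrite (reindex_omap Some id) //=; last by case.
by apply: eq_bigl => s; rewrite eqxx.
Qed.

(** Only the coordinates of the cells matter, so a skew shape may be indexed by any convenient type,
    such as a disjoint union of its pieces. *)
Lemma tableau_sum_cells (R : comNzRingType) m (C C' : finType)
    (row col : C -> nat) (row' col' : C' -> nat) (w : nat -> nat -> 'I_m -> R) :
    (forall s t, row s = row t -> col s = col t -> s = t) ->
    (forall s t, row' s = row' t -> col' s = col' t -> s = t) ->
    (forall s, exists t, row' t = row s /\ col' t = col s) ->
    (forall t, exists s, row s = row' t /\ col s = col' t) ->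
  \sum_(T : {ffun C -> 'I_m} | tableau row col T)
    \prod_s w (row s) (col s) (T s) =
  \sum_(T : {ffun C' -> 'I_m} | tableau row' col' T)
    \prod_s w (row' s) (col' s) (T s).
Proof.
move=> inj inj' /boolp.choice[g gP] /boolp.choice[f fP].
have fK : cancel f g.
  move=> t; have [r1 c1] := gP (f t); have [r2 c2] := fP t.
  by apply: inj'; rewrite ?r1 ?c1.
have gK : cancel g f.
  move=> s; have [r1 c1] := fP (g s); have [r2 c2] := gP s.
  by apply: inj; rewrite ?r1 ?c1.
rewrite (reindex (fun T : {ffun C' -> 'I_m} => [ffun s => T (g s)])) /=; last first.
  exists (fun T : {ffun C -> 'I_m} => [ffun t => T (f t)]) => T _;
    by apply/ffunP => s; rewrite !ffunE ?fK ?gK.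
apply: eq_big => [T|T _].
  apply/tableauP/tableauP => -[H1 H2]; split=> s t.
  - by have := H1 (f s) (f t); rewrite !ffunE !fK;
      case: (fP s) => -> ->; case: (fP t) => -> ->.
  - by have := H2 (f s) (f t); rewrite !ffunE !fK;
      case: (fP s) => -> ->; case: (fP t) => -> ->.
  - by have := H1 (g s) (g t); rewrite !ffunE;
      case: (gP s) => -> ->; case: (gP t) => -> ->.
  - by have := H2 (g s) (g t); rewrite !ffunE;
      case: (gP s) => -> ->; case: (gP t) => -> ->.
rewrite (reindex f) /=; last by exists g => ? _; rewrite ?fK ?gK.
by apply: eq_bigr => t _; rewrite ffunE fK; case: (fP t) => -> ->.
Qed.

(** * Loop Schur functions as minors *)

Section SkewCells.
Variables lam mu : seq nat.

Lemma skew_cell_inj (s t : skew_cell lam mu) :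
  cell_row s = cell_row t -> cell_col s = cell_col t -> s = t.
Proof.
rewrite /cell_row /cell_col => rst cst; apply/val_inj.
by rewrite [LHS]surjective_pairing [RHS]surjective_pairing;
  congr (_, _); apply: val_inj.
Qed.

Lemma skew_cellP (s : skew_cell lam mu) :
  [/\ (cell_row s < size lam)%N, (cell_col s < head 0 lam)%N &
      (nth 0 mu (cell_row s) <= cell_col s < nth 0 lam (cell_row s))%N].
Proof. by split; rewrite /cell_row /cell_col ?ltn_ord //; apply: (valP s). Qed.

Lemma skew_cell_ex a b : (a < size lam)%N -> (b < head 0 lam)%N ->
    (nth 0 mu a <= b < nth 0 lam a)%N ->
  exists s : skew_cell lam mu, cell_row s = a /\ cell_col s = b.
Proof.
move=> lt_a lt_b in_ab.
by exists (exist _ (Ordinal lt_a, Ordinal lt_b) in_ab).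
Qed.

End SkewCells.

Definition rect R N := skew_cell (nseq R N) [::].

Section Rectangles.
Variables R N : nat.

Lemma rect_row_lt (s : rect R N) : (cell_row s < R)%N.
Proof. by have [] := skew_cellP s; rewrite size_nseq. Qed.

Lemma rect_col_lt (s : rect R N) : (cell_col s < N)%N.
Proof.
by have [] := skew_cellP s; rewrite nth_nseq rect_row_lt => _ _ /andP[].
Qed.

Lemma rect_ex a b : (a < R)%N -> (b < N)%N ->
  exists s : rect R N, cell_row s = a /\ cell_col s = b.
Proof.
move=> lt_a lt_b; apply: skew_cell_ex; rewrite ?size_nseq //.
  by case: (R) lt_a.
by rewrite nth_nseq lt_a nth_nil.
Qed.

Definition rect_path (s : rect R N) : 'I_N := rev_ord (Ordinal (rect_col_lt s)).

Lemma rect_pathE s : (rect_path s + cell_col s).+1 = N.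
Proof. by rewrite /= -addSn subnSK ?rect_col_lt // subnK // ltnW ?rect_col_lt. Qed.

Variables (m : nat) (T : {ffun rect R N -> 'I_m}).
Hypothesis tabT : ssyt T.

Lemma rect_tableau_ge s : (cell_row s <= T s)%N.
Proof.
have [_ T_col] := tableauP _ _ _ (tabT : tableau _ _ T).
have [k] := ubnP (cell_row s); elim: k s => // k IH s; rewrite ltnS => le_k.
case rs : (cell_row s) => [//|a].
have lt_s := rect_row_lt s.
have [||t [rt ct]] := @rect_ex a (cell_col s); rewrite ?rect_col_lt //; first by lia.
have := T_col t s ct; rewrite rt rs => /(_ (ltnSn a)); apply: leq_ltn_trans.
by rewrite -rt; apply: IH; lia.
Qed.

Lemma rect_tableau_le s : (T s + (R - cell_row s) <= m)%N.
Proof.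
have [_ T_col] := tableauP _ _ _ (tabT : tableau _ _ T).
have [k] := ubnP (R - cell_row s); elim: k s => // k IH s; rewrite ltnS => le_k.
have lt_s := rect_row_lt s.
have [lt_R|le_R] := ltnP (cell_row s).+1 R; last first.
  by have := ltn_ord (T s); lia.
have [||t [rt ct]] := @rect_ex (cell_row s).+1 (cell_col s); rewrite ?rect_col_lt //.
have := T_col s t (esym ct); rewrite rt => /(_ (ltnSn _)) lt_T.
by have := IH t; rewrite rt; lia.
Qed.

End Rectangles.

Section LoopSchurMinors.
Variables (F : fieldType) (m n : nat) (x : 'M[F]_(m, n)).

Definition xnat (t p : nat) : F :=
  if insub t is Some i then if insub p is Some j then x i j else 0 else 0.

Lemma xnatE (i : 'I_m) (j : 'I_n) : xnat i j = x i j.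
Proof. by rewrite /xnat !valK. Qed.

Lemma xsup_mod (i : 'I_m) (r r' : int) :
  (r = r' %[mod n%:Z])%Z -> xsup x i r = xsup x i r'.
Proof.
move=> eq_r; rewrite /xsup; congr (if _ is Some j then _ else _).
apply: eq_pick => j; congr (_ == _); rewrite -!addrA.
by apply/eqP; rewrite eqz_modDr; apply/eqP.
Qed.

Lemma xsup_period (i : 'I_m) (r r' : int) (k : nat) :
  r = r' + (k * n)%:Z -> xsup x i r = xsup x i r'.
Proof. by move=> ->; apply: xsup_mod; rewrite PoszM addrC modzMDl. Qed.

Lemma xsupE (i : 'I_m) (r : int) (p : nat) : (p < n)%N -> (p + i).+1%:Z = r ->
  xsup x i r = xnat i p.
Proof.
move=> lt_pn <-; rewrite (_ : p = Ordinal lt_pn) // xnatE /xsup.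
have e (j : 'I_n) : (j.+1%:Z == (p + i).+1%:Z - i.+1%:Z + 1 %[mod n%:Z])%Z = (j == Ordinal lt_pn).
  rewrite (_ : _ + 1 = p.+1%:Z); last by lia.
  rewrite -[j.+1]addn1 -[p.+1]addn1 !PoszD eqz_modDr !modz_nat.
  by rewrite !modn_small.
case: pickP => [j|/(_ (Ordinal lt_pn))]; first by rewrite e => /eqP ->.
by rewrite e eqxx.
Qed.

Lemma loop_schurE r lam mu : loop_schur x r lam mu =
  \sum_(T : {ffun skew_cell lam mu -> 'I_m} | tableau (@cell_row lam mu) (@cell_col lam mu) T)
    \prod_s xsup x (T s) ((cell_row s)%:Z - (cell_col s)%:Z + r).
Proof. by []. Qed.

Definition rect_wt R N (T : {ffun rect R N -> 'I_m}) : F :=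
  \prod_s xsup x (T s) (content s + n%:Z).

Variables (R N : nat).
Hypotheses (leNn : (N <= n)%N) (R_m : (R + (n - N) = m)%N).
Let e := (n - N)%N.

(** Strict columns give row <= T <= row + (n - N), since R + (n - N) = m. The column index then
    stays between 0 and n - 1, so the cyclic superscript does not wrap. *)
Lemma rect_wtE (T : {ffun rect R N -> 'I_m}) : ssyt T ->
  rect_wt T = \prod_s xnat (T s) (e + rect_path s + cell_row s - T s)%N.
Proof.
move=> tabT; apply: eq_bigr => s _.
have := rect_tableau_ge tabT s; have := rect_tableau_le tabT s.
have := rect_row_lt s; have := rect_col_lt s; have := rect_pathE s.
move=> p1 p2 p3 p4 p5.
apply: xsupE; rewrite /content /e; lia.
Qed.

Lemma loop_schur_rect (i0 : 'I_m) :
  loop_schur x n%:Z (nseq R N) [::] = Dmin xnat m e N.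
Proof.
rewrite loop_schurE (eq_bigr (fun T : {ffun rect R N -> 'I_m} => \prod_s xnat (T s)
  (e + rect_path s + cell_row s - T s)%N)) => [|T tabT]; last exact: rect_wtE.
rewrite -(det_tableaux xnat i0 (lo := fun=> 0%N) (hi := fun=> R) (c := fun l => l)).
- by congr (\det _); apply/matrixP => l l'; rewrite !mxE addn0.
- by move=> s t; have := rect_pathE s; have := rect_pathE t; lia.
- move=> s t /(congr1 val) /= pst rst; apply: skew_cell_inj => //.
  by have := rect_pathE s; have := rect_pathE t; lia.
- by move=> s; apply: rect_row_lt.
- move=> l a /= lt_aR; have lt_l := ltn_ord l.
  have [|s [rs cs]] := @rect_ex R N a (N - l.+1) lt_aR; first by lia.
  by exists s => //; apply: ord_inj; have := rect_pathE s; rewrite cs; lia.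
- by [].
- by [].
- by [].
- by move=> l; rewrite -R_m /e; lia.
Qed.

Definition above_corner (T : {ffun rect R N -> 'I_m}) (c : 'I_m) :=
  [forall s : rect R N, (cell_col s == N.-1) ==> (c < T s)%N].

Definition below_corner (T : {ffun rect R N -> 'I_m}) (c : 'I_m) :=
  [forall s : rect R N, (cell_col s == 0%N) ==> (T s < c)%N].

(* The paths of this minor are tableaux of the rectangle with one more cell [c]
   on top of the last column. *)
Lemma Hmin_rect (i0 : 'I_m) : (0 < N)%N -> (0 < R)%N -> (0 < e)%N ->
  Hmin xnat m e.-1 N =
  \sum_(T : {ffun rect R N -> 'I_m} | ssyt T)
    rect_wt T * \sum_(c | above_corner T c) xsup x c e%:Z.
Proof.
move=> N_gt0 R_gt0 e_gt0.
pose row' (o : option (rect R N)) := if o is Some s then (cell_row s).+1 else 0%N.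
pose col' (o : option (rect R N)) := if o is Some s then cell_col s else N.-1.
pose l0 : 'I_N := Ordinal N_gt0.
pose pth' (o : option (rect R N)) := if o is Some s then rect_path s else l0.
have pthE o : (pth' o + col' o).+1 = N.
  by case: o => [s|] /=; [apply: rect_pathE | rewrite add0n prednK].
have := det_tableaux xnat i0 (C := option (rect R N)) (row := row') (col := col')
  (pth := pth') (e := e.-1) (lo := fun l => (l != l0) : nat) (hi := fun=> R.+1) (c := fun l => l).
move=> dt; transitivity (\det (\matrix_(l < N, l' < N)
    Mnat xnat m (e.-1 + l + (l != l0)) l')).
  congr (\det _); apply/matrixP => l l'; rewrite !mxE -addnA; congr (Mnat _ _ (_ + _) _).
  by rewrite /bump -val_eqE /=; lia.
rewrite dt {dt}.
- rewrite sum_ffun_option [RHS]big_mkcond; apply: eq_bigr => T _ /=.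
  have tabE c : tableau row' col' (fcons c T) = ssyt T && above_corner T c.
    apply/tableauP/andP => [[H1 H2]|[tabT /forallP above]].
      split; last first.
        apply/forallP => s; apply/implyP => /eqP cs.
        by have := H2 None (Some s); rewrite !ffunE /= cs => /(_ erefl isT).
      apply/tableauP; split=> s t st.
        by have := H1 (Some s) (Some t); rewrite !ffunE /= st => /(_ erefl).
      by have := H2 (Some s) (Some t); rewrite !ffunE /= st => /(_ erefl).
    have [T1 T2] := tableauP _ _ _ (tabT : tableau _ _ T).
    split=> -[s|] [t|]; rewrite !ffunE //=; first by move=> [/T1].
      exact: T2.
    by move=> ct _; apply: (implyP (above t)); rewrite -ct.
  under eq_bigl do rewrite tabE.
  case: ifP => tabT; last by rewrite big_pred0.
  rewrite big_distrr; apply: eq_bigr => c /forallP above /=.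
  rewrite prod_option !ffunE /= rect_wtE //; congr (_ * _).
    by apply: eq_bigr => s _; rewrite ffunE /=; congr (xnat _ _); lia.
  have [|s [rs cs]] := @rect_ex R N 0 N.-1 R_gt0; first by rewrite prednK.
  have /implyP := above s; rewrite cs eqxx => /(_ isT) lt_cT.
  (* The top right entry is at most e, hence c < e and the superscript e of the added cell does not
     wrap. *)
  have := rect_tableau_le tabT s; rewrite rs subn0 -[X in (_ <= X)%N]R_m => le_T.
  apply/esym/xsupE; rewrite /e in e_gt0 *; lia.
- by move=> s t; have := pthE s; have := pthE t; lia.
- move=> s t /(congr1 val) /= pst rst.
  have cst : col' s = col' t by have := pthE s; have := pthE t; lia.
  by case: s t pst rst cst => [s|] [t|] //= _ [rst] cst; congr Some; apply: skew_cell_inj.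
- by move=> [s|] /=; rewrite ?eqxx // ltnS rect_row_lt andbT; case: eqP.
- move=> l [|a] /= lt_a.
    exists None => //=; apply/eqP; move: lt_a; rewrite eq_sym.
    by case: eqP.
  have lt_l := ltn_ord l; have lt_aR : (a < R)%N by case/andP: lt_a.
  have [|s [rs cs]] := @rect_ex R N a (N - l.+1) lt_aR; first by lia.
  exists (Some s); rewrite /= ?rs //.
  by apply: ord_inj; have := rect_pathE s; rewrite cs; lia.
- by move=> l l'; rewrite -!val_eqE /=; lia.
- by [].
- by move=> l; case: eqP.
- by move=> l; move: R_m e_gt0; rewrite /e; lia.
Qed.

(* The paths of this minor are tableaux of the rectangle with one more cell [c]
   below the first column. *)
Lemma Cmin_rect (i0 : 'I_m) : (0 < N)%N -> (0 < R)%N ->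
  Cmin xnat m e N =
  \sum_(T : {ffun rect R N -> 'I_m} | ssyt T)
    rect_wt T * \sum_(c | below_corner T c) xsup x c (m + N)%:Z.
Proof.
move=> N_gt0 R_gt0.
pose row' (o : option (rect R N)) := if o is Some s then cell_row s else R.
pose col' (o : option (rect R N)) := if o is Some s then cell_col s else 0%N.
have lt_l1 : (N.-1 < N)%N by rewrite prednK.
pose l1 : 'I_N := Ordinal lt_l1.
pose pth' (o : option (rect R N)) := if o is Some s then rect_path s else l1.
have pthE o : (pth' o + col' o).+1 = N.
  by case: o => [s|] /=; [apply: rect_pathE | rewrite addn0 prednK].
have := det_tableaux xnat i0 (C := option (rect R N)) (row := row') (col := col')
  (pth := pth') (e := e) (lo := fun l => 0%N) (hi := fun l => (R + (l == l1))%N)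
  (c := fun l => bump N.-1 l).
move=> dt; transitivity (\det (\matrix_(l < N, l' < N)
    Mnat xnat m (e + l + 0) (bump N.-1 l'))).
  by congr (\det _); apply/matrixP => l l'; rewrite !mxE addn0.
rewrite dt {dt}.
- rewrite sum_ffun_option [RHS]big_mkcond; apply: eq_bigr => T _ /=.
  have tabE c : tableau row' col' (fcons c T) = ssyt T && below_corner T c.
    apply/tableauP/andP => [[H1 H2]|[tabT /forallP below]].
      split; last first.
        apply/forallP => s; apply/implyP => /eqP cs.
        have := H2 (Some s) None; rewrite !ffunE /= cs => /(_ erefl).
        by apply; apply: rect_row_lt.
      apply/tableauP; split=> s t st.
        by have := H1 (Some s) (Some t); rewrite !ffunE /= st => /(_ erefl).
      by have := H2 (Some s) (Some t); rewrite !ffunE /= st => /(_ erefl).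
    have [T1 T2] := tableauP _ _ _ (tabT : tableau _ _ T).
    split=> -[s|] [t|]; rewrite !ffunE //=.
    - exact: T1.
    - by move=> rs; have := rect_row_lt s; rewrite rs ltnn.
    - by move=> rs; have := rect_row_lt t; rewrite -rs ltnn.
    - exact: T2.
    - by move=> cs _; apply: (implyP (below s)); rewrite cs.
    - by move=> _ lt_R; have := rect_row_lt t; lia.
    - by rewrite ltnn.
  under eq_bigl do rewrite tabE.
  case: ifP => tabT; last by rewrite big_pred0.
  rewrite big_distrr; apply: eq_bigr => c /forallP below /=.
  rewrite prod_option !ffunE /= rect_wtE //; congr (_ * _).
    by apply: eq_bigr => s _; rewrite ffunE /=; congr (xnat _ _); lia.
  have [|s [rs cs]] := @rect_ex R N R.-1 0 _ N_gt0; first by rewrite prednK.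
  have /implyP := below s; rewrite cs eqxx => /(_ isT) lt_cT.
  (* The bottom left entry is at least R - 1, hence c >= R, which keeps the column index of the
     added cell below n. *)
  have := rect_tableau_ge tabT s; rewrite rs => le_T.
  apply/esym/xsupE; have := ltn_ord c; rewrite /e; lia.
- by move=> s t; have := pthE s; have := pthE t; lia.
- move=> s t /(congr1 val) /= pst rst.
  have cst : col' s = col' t by have := pthE s; have := pthE t; lia.
  case: s t pst rst cst => [s|] [t|] //= _ rst cst; first by congr Some; apply: skew_cell_inj.
    by have := rect_row_lt s; rewrite rst ltnn.
  by have := rect_row_lt t; rewrite -rst ltnn.
- by move=> [s|] /=; rewrite ?eqxx ?addn1 // (leq_trans (rect_row_lt s)) ?leq_addr.
- move=> l a /= lt_a.
  have [aR|ne_aR] := eqVneq a R.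
    exists None => //=; apply/eqP; move: lt_a; rewrite aR eq_sym.
    by case: eqP => //; rewrite addn0 ltnn.
  have lt_l := ltn_ord l; have lt_aR : (a < R)%N by move: lt_a ne_aR; lia.
  have [|s [rs cs]] := @rect_ex R N a (N - l.+1) lt_aR; first by lia.
  exists (Some s); rewrite /= ?rs //.
  by apply: ord_inj; have := rect_pathE s; rewrite cs; lia.
- by [].
- by move=> l l'; rewrite -!val_eqE /=; have := ltn_ord l; have := ltn_ord l'; lia.
- by [].
- by move=> l; rewrite -val_eqE /= /bump; have := ltn_ord l; move: R_m; rewrite /e; lia.
Qed.

End LoopSchurMinors.

Section RowConditions.
Variables (m R N : nat).
Implicit Types (T : {ffun rect R N -> 'I_m}) (c : 'I_m).

Definition row0_le T c := [forall s, (cell_row s == 0%N) ==> (T s <= c)%N].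
Definition last_row_ge T c := [forall s, (cell_row s == R.-1) ==> (c <= T s)%N].

(** The top right entry is both the maximum of the first row and the minimum of the last column. *)
Lemma row0_leN T c : ssyt T -> (0 < N)%N -> (0 < R)%N ->
  ~~ row0_le T c = above_corner T c.
Proof.
move=> tabT N_gt0 R_gt0.
have [T_row T_col] := tableauP _ _ _ (tabT : tableau _ _ T).
have [|s0 [r0 c0]] := @rect_ex R N 0 N.-1 R_gt0; first by rewrite prednK.
apply/forallPn/forallP => [[s]|H].
  rewrite negb_imply -ltnNge => /andP[/eqP rs lt_c] t; apply/implyP => /eqP ct.
  have le_s : (T s <= T s0)%N.
    by apply: T_row; rewrite ?rs ?r0 // c0; have := rect_col_lt s; lia.
  apply: leq_trans lt_c (leq_trans le_s _).
  have [rt|rt] := eqVneq (cell_row t) 0%N.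
    by apply: T_row; rewrite ?r0 ?rt // c0 ct.
  by apply: ltnW; apply: T_col; rewrite ?c0 ?ct // r0 lt0n.
exists s0; rewrite negb_imply r0 eqxx -ltnNge /=.
by apply: (implyP (H s0)); rewrite c0.
Qed.

(** The bottom left entry is both the minimum of the last row and the maximum of the first
    column. *)
Lemma last_row_geN T c : ssyt T -> (0 < N)%N -> (0 < R)%N ->
  ~~ last_row_ge T c = below_corner T c.
Proof.
move=> tabT N_gt0 R_gt0.
have [T_row T_col] := tableauP _ _ _ (tabT : tableau _ _ T).
have [|s0 [r0 c0]] := @rect_ex R N R.-1 0 _ N_gt0; first by rewrite prednK.
apply/forallPn/forallP => [[s]|H].
  rewrite negb_imply -ltnNge => /andP[/eqP rs lt_c] t; apply/implyP => /eqP ct.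
  have le_s : (T s0 <= T s)%N by apply: T_row; rewrite ?rs ?r0 // c0.
  apply: leq_ltn_trans _ (leq_ltn_trans le_s lt_c).
  have [rt|rt] := eqVneq (cell_row t) R.-1.
    by apply: T_row; rewrite ?r0 ?rt // c0 ct.
  apply: ltnW; apply: T_col; rewrite ?c0 ?ct // r0.
  by have := rect_row_lt t; lia.
exists s0; rewrite negb_imply r0 eqxx -ltnNge /=.
by apply: (implyP (H s0)); rewrite c0.
Qed.

Lemma row0_le_width0 T c : N = 0%N -> row0_le T c.
Proof. by move=> N0; apply/forallP => s; have := rect_col_lt s; lia. Qed.

Lemma last_row_ge_width0 T c : N = 0%N -> last_row_ge T c.
Proof. by move=> N0; apply/forallP => s; have := rect_col_lt s; lia. Qed.

End RowConditions.

(** * Cutting the shape of the reduced invariant *)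

Section ReducedShape.
Variables (F : fieldType) (m n j K z : nat) (x : 'M[F]_(m, n)).
Hypotheses (j_gt0 : (0 < j)%N) (le_jn : (j <= n)%N) (lt_jm : (j < m)%N).
Hypotheses (lt_Kn : (K < n)%N) (mK : (m + K = j + z.+1 * n)%N).

Let NA := (n - j)%N.
Let RA := (m - j)%N.
Let RB := (m + K - n)%N.
Let lam := nseq RB (n - j + K + 1)%N ++ nseq (m - (1 + j))%N (n - j)%N.
Let mu := nseq (RB - 1)%N (n - j + 1)%N.

Let le_jRB : (j <= RB)%N.
Proof. by rewrite /RB mK mulSn; lia. Qed.

Let size_lam : size lam = (RB + RA).-1.
Proof. by rewrite size_cat !size_nseq /RA; lia. Qed.

Let head_lam : head 0%N lam = (NA + K).+1.
Proof. by rewrite /lam; case: (RB) le_jRB => [|r] /=; rewrite /NA; lia. Qed.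

Let nth_lam a : (a < (RB + RA).-1)%N ->
  nth 0%N lam a = if (a < RB)%N then (NA + K).+1 else NA.
Proof.
move=> lt_a; rewrite nth_cat size_nseq; case: ltnP => lt_aR.
  by rewrite nth_nseq lt_aR addn1.
by rewrite nth_nseq (_ : (_ < _)%N) //; move: lt_a; rewrite /RA; lia.
Qed.

Let nth_mu a : nth 0%N mu a = if (a < RB.-1)%N then NA.+1 else 0%N.
Proof. by rewrite nth_nseq subn1 addn1. Qed.

(* The rectangle RA x NA to the lower left, the rectangle RB x K to the upper
   right, and [None] for the cell that joins them. *)
Let cells : finType := option (rect RA NA + rect RB K)%type.

Let rowc (o : cells) : nat :=
  match o with
  | Some (inl s) => cell_row s + RB.-1
  | Some (inr t) => cell_row t
  | None => RB.-1
  end%N.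

Let colc (o : cells) : nat :=
  match o with
  | Some (inl s) => cell_col s
  | Some (inr t) => cell_col t + NA.+1
  | None => NA
  end%N.

Lemma red_tableauE (T : {ffun rect RA NA -> 'I_m}) (T' : {ffun rect RB K -> 'I_m})
    (c : 'I_m) :
  tableau rowc colc (fcons c (fsum T T')) =
  [&& ssyt T, ssyt T', row0_le T c & last_row_ge T' c].
Proof.
apply/tableauP/and4P => [[H1 H2]|[tabT tabT' /forallP T_c /forallP c_T']].
  split.
  - apply/tableauP; split=> s t st.
      have := H1 (Some (inl s)) (Some (inl t)); rewrite !ffunE /= st.
      exact.
    have := H2 (Some (inl s)) (Some (inl t)); rewrite !ffunE /= st ltn_add2r.
    exact.
  - apply/tableauP; split=> s t st.
      have := H1 (Some (inr s)) (Some (inr t)); rewrite !ffunE /= st leq_add2r.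
      exact.
    have := H2 (Some (inr s)) (Some (inr t)); rewrite !ffunE /= st.
    exact.
  - apply/forallP => s; apply/implyP => /eqP rs.
    have := H1 (Some (inl s)) None; rewrite !ffunE /= rs; apply => //.
    exact/ltnW/rect_col_lt.
  - apply/forallP => s; apply/implyP => /eqP rs.
    have := H1 None (Some (inr s)); rewrite !ffunE /= rs; apply => //.
    by rewrite addnS ltnW // ltnS leq_addl.
have [T1 T2] := tableauP _ _ _ (tabT : tableau _ _ T).
have [T1' T2'] := tableauP _ _ _ (tabT' : tableau _ _ T').
split=> -[[s|s]|] [[t|t]|]; rewrite !ffunE //=.
- by move=> /addIn; apply: T1.
- move=> rst _; have rt := rect_row_lt t.
  have /implyP/(_ _) le_c := T_c s; have /implyP/(_ _) ge_c := c_T' t.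
  by apply: leq_trans (le_c _) (ge_c _); lia.
- by move=> rs _; apply: (implyP (T_c s)); lia.
- by have := rect_col_lt t; lia.
- by rewrite leq_add2r; apply: T1'.
- by lia.
- by have := rect_col_lt t; lia.
- by move=> rt _; apply: (implyP (c_T' t)); rewrite -rt.
- by rewrite ltn_add2r; apply: T2.
- by have := rect_col_lt s; lia.
- by have := rect_col_lt s; lia.
- by have := rect_col_lt t; lia.
- by move=> /addIn; apply: T2'.
- by lia.
- by have := rect_col_lt t; lia.
- by lia.
- by rewrite ltnn.
Qed.

Let rowcol_inj o o' : rowc o = rowc o' -> colc o = colc o' -> o = o'.
Proof.
case: o o' => [[s|s]|] [[t|t]|] //=.
- by move=> /addIn rst cst; congr (Some (inl _)); apply: skew_cell_inj.
- by have := rect_col_lt s; lia.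
- by have := rect_col_lt s; lia.
- by have := rect_col_lt t; lia.
- by move=> rst /addIn cst; congr (Some (inr _)); apply: skew_cell_inj.
- by lia.
- by have := rect_col_lt t; lia.
- by lia.
Qed.

Let cells_ex (s : skew_cell lam mu) :
  exists o, rowc o = cell_row s /\ colc o = cell_col s.
Proof.
have [] := skew_cellP s; rewrite size_lam head_lam => lt_r lt_c.
rewrite nth_lam // nth_mu => /andP[].
have [lt_q|le_q] := ltnP (cell_row s) RB.-1.
  rewrite (_ : (cell_row s < RB)%N); last by lia.
  move=> le_N _.
  have [||t [rt ct]] := @rect_ex RB K (cell_row s) (cell_col s - NA.+1); [lia..|].
  by exists (Some (inr t)); rewrite /= rt ct; split=> //; lia.
move=> _ lt_c'.
have [lt_cN|] := ltnP (cell_col s) NA.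
  have [|t [rt ct]] := @rect_ex RA NA (cell_row s - RB.-1) (cell_col s) _ lt_cN;
    first by lia.
  by exists (Some (inl t)); rewrite /= rt ct; split=> //; lia.
rewrite leq_eqVlt => /predU1P[Nc|lt_Nc].
  by exists None; rewrite /= -Nc; split=> //; move: lt_c'; case: (ltnP _ RB); lia.
move: lt_c'; case: (ltnP _ RB) => lt_RB lt_c'; last by lia.
have [||t [rt ct]] := @rect_ex RB K (cell_row s) (cell_col s - NA.+1); [lia..|].
by exists (Some (inr t)); rewrite /= rt ct; split=> //; lia.
Qed.

Let skew_ex o : exists s : skew_cell lam mu, cell_row s = rowc o /\ cell_col s = colc o.
Proof.
have RB_gt0 : (0 < RB)%N by apply: leq_trans j_gt0 le_jRB.
have RA_gt0 : (0 < RA)%N by rewrite subn_gt0.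
have lt_r : (rowc o < (RB + RA).-1)%N.
  case: o => [[s|s]|] /=; last by lia.
    by have := rect_row_lt s; lia.
  by have := rect_row_lt s; lia.
apply: skew_cell_ex; rewrite ?size_lam ?head_lam ?nth_lam ?nth_mu //.
  by case: o {lt_r} => [[s|s]|] /=; try have := rect_col_lt s; lia.
case: o lt_r => [[s|s]|] /= lt_r.
- have := rect_col_lt s; case: (ltnP _ RB.-1); first by lia.
  by case: (ltnP _ RB); lia.
- have := rect_col_lt s; have := rect_row_lt s => ->; case: (ltnP _ RB.-1); lia.
- by rewrite ltnn /=; case: (ltnP _ RB); lia.
Qed.

(** Relative to separate rectangles with superscript offset n, the superscripts are z n too large in
    the lower left part and n too small in the upper right part; the joining cell has superscript j
    + z n. All these shifts are periods. *)
Lemma loop_schur_red :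
  loop_schur x (n%:Z - j%:Z + 1) lam mu =
  \sum_(T : {ffun rect RA NA -> 'I_m} | ssyt T)
    \sum_(T' : {ffun rect RB K -> 'I_m} | ssyt T')
      rect_wt x T * rect_wt x T' *
      \sum_(c | row0_le T c && last_row_ge T' c) xsup x c j%:Z.
Proof.
rewrite loop_schurE.
pose w (a b : nat) (t : 'I_m) := xsup x t (a%:Z - b%:Z + (n%:Z - j%:Z + 1)).
rewrite (tableau_sum_cells w (row' := rowc) (col' := colc) _ rowcol_inj cells_ex skew_ex);
  last exact: skew_cell_inj.
rewrite sum_ffun_option sum_ffun_sum [RHS]big_mkcond; apply: eq_bigr => T _ /=.
have [tabT|ntabT] := boolP (ssyt T); last first.
  rewrite big1 // => T' _; rewrite big_pred0 // => c.
  by rewrite red_tableauE (negPf ntabT).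
rewrite [RHS]big_mkcond; apply: eq_bigr => T' _ /=.
under eq_bigl do rewrite red_tableauE tabT.
have [tabT'|ntabT'] := boolP (ssyt T') => /=; last by rewrite big_pred0.
rewrite big_distrr; apply: eq_bigr => c _ /=.
rewrite prod_option; congr (_ * _).
  rewrite big_sumType /=; congr (_ * _); apply: eq_bigr => s _; rewrite !ffunE.
    by apply: (@xsup_period _ _ _ _ _ _ _ z); rewrite /content /=; lia.
  apply/esym/(@xsup_period _ _ _ _ _ _ _ 1); rewrite /content /=; lia.
by rewrite ffunE /w; apply: (@xsup_period _ _ _ _ _ _ _ z) => /=; lia.
Qed.

Lemma loop_schur_red_minors (i0 : 'I_m) :
  let D := Dmin (xnat x) m in
  loop_schur x (n%:Z - j%:Z + 1) lam mu =
    D j NA * D (n - K)%N K * E1 x j%:Z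
    - (if NA == 0%N then 0 else Hmin (xnat x) m j.-1 NA) * D (n - K)%N K
    - D j NA * (if K == 0%N then 0 else Cmin (xnat x) m (n - K) K).
Proof.
move=> D.
have nNA : (n - NA = j)%N by rewrite subKn.
have RA_gt0 : (0 < RA)%N by rewrite subn_gt0.
have RB_gt0 : (0 < RB)%N by apply: leq_trans j_gt0 le_jRB.
have RA_m : (RA + (n - NA) = m)%N by rewrite nNA subnK // ltnW.
have RB_m : (RB + (n - K) = m)%N by rewrite /RB; lia.
have DA : D j NA = \sum_(T : {ffun rect RA NA -> 'I_m} | ssyt T) rect_wt x T.
  by rewrite /D -nNA -(loop_schur_rect x _ RA_m i0) ?leq_subr.
have DB : D (n - K)%N K = \sum_(T : {ffun rect RB K -> 'I_m} | ssyt T) rect_wt x T.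
  by rewrite /D -(loop_schur_rect x _ RB_m i0) // ltnW.
have HA : (if NA == 0%N then 0 else Hmin (xnat x) m j.-1 NA) =
    \sum_(T : {ffun rect RA NA -> 'I_m} | ssyt T)
      rect_wt x T * \sum_(c | ~~ row0_le T c) xsup x c j%:Z.
  case: posnP => [NA0|NA_gt0].
    rewrite big1 // => T _; rewrite big_pred0 ?mulr0 // => c.
    by rewrite row0_le_width0.
  rewrite -[X in Hmin _ _ X.-1 _]nNA (Hmin_rect x _ RA_m i0) ?nNA ?leq_subr //.
  by apply: eq_bigr => T tabT; under [in RHS]eq_bigl do rewrite row0_leN //.
have CB : (if K == 0%N then 0 else Cmin (xnat x) m (n - K) K) =
    \sum_(T : {ffun rect RB K -> 'I_m} | ssyt T)
      rect_wt x T * \sum_(c | ~~ last_row_ge T c) xsup x c j%:Z.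
  case: posnP => [K0|K_gt0].
    rewrite big1 // => T _; rewrite big_pred0 ?mulr0 // => c.
    by rewrite last_row_ge_width0.
  rewrite (Cmin_rect x _ RB_m i0) ?(ltnW lt_Kn) //.
  apply: eq_bigr => T tabT; under [in RHS]eq_bigl do rewrite last_row_geN //.
  congr (_ * _); apply: eq_bigr => c _.
  (* [Cmin_rect] gives the added cell superscript m + K, which is j plus z + 1 periods. *)
  by apply: (@xsup_period _ _ _ _ _ _ _ z.+1); rewrite mK.
rewrite loop_schur_red HA CB DA DB.
(* [E1] is itself a sum; abstracting it keeps it a scalar under the distributivity rewrites. *)
have [e2 e2E] : exists e2, e2 = E1 x j%:Z by exists (E1 x j%:Z).
rewrite -e2E !big_distrlr /= big_distrl /= -!sumrB.
apply: eq_bigr => T tabT; rewrite big_distrl /= -!sumrB.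
apply: eq_bigr => T' tabT'.
have -> : \sum_(c | row0_le T c && last_row_ge T' c) xsup x c j%:Z =
    e2 - \sum_(c | ~~ row0_le T c) xsup x c j%:Z
      - \sum_(c | ~~ last_row_ge T' c) xsup x c j%:Z.
  rewrite e2E /E1 [LHS]big_mkcond [X in _ - X - _]big_mkcond [X in _ - _ - X]big_mkcond /=.
  rewrite -!sumrB; apply: eq_bigr => c _.
  (* If both failed, c would be smaller than a first-row entry of T, which is at most m - RA = j,
     and larger than a last-row entry of T', which is at least RB - 1 >= j - 1. *)
  have : row0_le T c || last_row_ge T' c.
    rewrite -[X in X || _]negbK -implybE; apply/implyP => /forallPn[s].
    rewrite negb_imply -ltnNge => /andP[/eqP rs lt_c].
    apply/forallP => t; apply/implyP => /eqP rt; rewrite leqNgt; apply/negP => lt_t.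
    have := leq_ltn_trans (rect_tableau_ge tabT' t) lt_t; rewrite rt.
    have := leq_trans (leq_add lt_c (leqnn _)) (rect_tableau_le tabT s).
    by rewrite rs /RA; lia.
  by case: (row0_le T c); case: (last_row_ge T' c) => //= _;
    rewrite ?subr0 ?subrr ?sub0r ?oppr0.
by ring.
Qed.

End ReducedShape.

(** * The decorations *)

HB.instance Definition _ (F : fieldType) (n : nat) :=
  Monoid.isLaw.Build 'M[F]_n 1%:M (@mulmx F n n n)
    (@mulmxA F n n n n) (@mul1mx F n n) (@mulmx1 F n n).

Section FlagMinors.
Variables (F : fieldType) (m n : nat) (x : 'M[F]_(m, n)).

Lemma MmxE k (a b : 'I_n) : (k <= m)%N -> Mmx x k a b = Mnat (xnat x) k a b.
Proof.
move=> le_km; rewrite /Mmx (big_ord_narrow le_km).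
elim: k le_km b => [|k IH] le_km b.
  by rewrite big_ord0 mxE /Mnat val_eqE.
have ME c : (\big[mulmx/1%:M]_(i < k)
    Wmx (row (widen_ord le_km (widen_ord (leqnSn k) i)) x)) a c = Mnat (xnat x) k a c.
  rewrite -(IH (ltnW le_km)); congr (fun_of_matrix _ a c); apply: eq_bigr => i _.
  by congr (Wmx (row _ x)); apply: val_inj.
rewrite big_ord_recr /= MnatS mxE.
rewrite (bigD1 b) //= !mxE eqxx ME mulrC -(xnatE x); congr (_ + _).
have [lt_bn|le_nb] := ltnP b.+1 n.
  rewrite (bigD1 (Ordinal lt_bn)) /=; last by rewrite -val_eqE /= gtn_eqF.
  rewrite mxE -val_eqE /= gtn_eqF // eqxx mulr1 ME big1 ?addr0 // => c.
  rewrite -!val_eqE /= mxE -val_eqE => /andP[/negPf-> /negPf->].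
  by rewrite mulr0.
(* In the last column the recursion reaches outside the n x n matrix, where lower triangularity
   gives 0. *)
rewrite Mnat_upper; last by have := ltn_ord a; lia.
rewrite big1 // => c ne_cb; rewrite mxE (negPf ne_cb) ifN ?mulr0 //.
by have := ltn_ord c; lia.
Qed.

Lemma enum_itvset i j : (0 < i)%N -> (i <= j.+1)%N -> (j <= n)%N ->
  map val (enum (itvset n i j)) = iota i.-1 (j.+1 - i).
Proof.
move=> i_gt0 le_ij le_jn.
rewrite /enum_mem -enumT.
rewrite (eq_filter (a2 := preim val (fun c => i <= c.+1 <= j)%N)) => [|c]; last first.
  by rewrite !inE.
rewrite -filter_map val_enum_ord.
have nE : n = (i.-1 + (j.+1 - i + (n - j)))%N by lia.
have -> : iota 0 n = iota 0 i.-1 ++ iota i.-1 (j.+1 - i) ++ iota j (n - j).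
  rewrite [in LHS]nE !iotaD add0n.
  by have -> : (i.-1 + (j.+1 - i) = j)%N by lia.
pose p c := (i <= c.+1 <= j)%N; rewrite -/p.
have p_out a l : (forall c, (a <= c < a + l)%N -> ~~ p c) -> filter p (iota a l) = [::].
  move=> np; rewrite -(filter_pred0 (iota a l)); apply: eq_in_filter => c.
  by rewrite mem_iota => /np/negPf.
rewrite !filter_cat (p_out 0%N) ?(p_out j); [|by rewrite /p; lia..].
rewrite cats0 cat0s; apply/all_filterP/allP => c; rewrite mem_iota /p; lia.
Qed.

Lemma Delta_itvset (A : 'M[F]_n) (g : nat -> nat -> F) i j :
    (forall a b : 'I_n, A a b = g a b) ->
    (0 < i)%N -> (i <= j.+1)%N -> (j <= n)%N ->
  Delta (itvset n i j) A = dcol (j.+1 - i) (fun c r => g (i.-1 + r)%N c).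
Proof.
move=> Ag i_gt0 le_ij le_jn; have enumE := enum_itvset i_gt0 le_ij le_jn.
have cardE : #|itvset n i j| = (j.+1 - i)%N.
  by rewrite cardE -(size_map val) enumE size_iota.
rewrite /Delta /dcol.
have enum_valE (r : 'I_#|itvset n i j|) : (i.-1 + r)%N = enum_val r.
  have lt_r : (r < j.+1 - i)%N by rewrite -cardE.
  rewrite -(nth_iota 0 i.-1 lt_r) -enumE (nth_map (enum_val r)) ?enum_valP //.
    by rewrite -(enum_val_nth (enum_val r)).
  by rewrite -fintype.cardE; apply: ltn_ord.
transitivity (\det (\matrix_(r < #|itvset n i j|, c < #|itvset n i j|) g (i.-1 + r)%N c)).
  by congr (\det _); apply/matrixP => r c; rewrite !mxE Ag enum_valE.
by rewrite cardE.
Qed.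

Lemma Delta_Mmx k i j : (k <= m)%N -> (0 < i)%N -> (i <= j.+1)%N -> (j <= n)%N ->
  Delta (itvset n i j) (Mmx x k) = Dmin (xnat x) k i.-1 (j.+1 - i).
Proof. by move=> le_km *; apply: Delta_itvset => // a b; apply: MmxE. Qed.

Lemma PpatE i j : (0 < i)%N -> (i <= j)%N -> (j <= n)%N ->
  Ppat x i j = Pmin (xnat x) m i j.
Proof.
move=> i_gt0 le_ij le_jn.
by rewrite /Ppat !Delta_Mmx // leqW.
Qed.

Lemma QpatE i j : (0 < j)%N -> (j <= n)%N -> (i <= m)%N ->
  Qpat x j i = Qmin (xnat x) n j i.
Proof. by move=> j_gt0 le_jn le_im; rewrite /Qpat !Delta_Mmx // leqW. Qed.

Lemma decorP_pat : (0 < m)%N -> decorP m n (Ppat x) = decorP m n (Pmin (xnat x) m).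
Proof.
move=> m_gt0; rewrite /decorP; congr (_ + _ + _).
- apply: eq_big_nat => i /andP[i_gt0 _]; apply: eq_big_nat => j /andP[le_ij lt_jn].
  by rewrite !PpatE //; lia.
- apply: eq_big_nat => i /andP[i_gt0 _]; apply: eq_big_nat => j /andP[le_ij lt_jn].
  by rewrite !PpatE //; lia.
- by case: ifP => // lt_mn; rewrite PpatE // ltnW.
Qed.

Lemma decorQ_pat : (0 < n)%N -> decorQ m n (Qpat x) = decorQ m n (Qmin (xnat x) n).
Proof.
move=> n_gt0; rewrite /decorQ; congr (_ + _ + _).
- apply: eq_big_nat => j /andP[j_gt0 lt_jn]; apply: eq_big_nat => i /andP[le_ji lt_im].
  by rewrite !QpatE //; lia.
- apply: eq_big_nat => j /andP[j_gt0 lt_jn]; apply: eq_big_nat => i /andP[le_ji lt_im].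
  by rewrite !QpatE //; lia.
- by case: ifP => // lt_nm; rewrite QpatE // ltnW.
Qed.

Hypothesis D_neq0 : forall k a N,
  (k <= m)%N -> (a <= k)%N -> (a + N <= n)%N -> Dmin (xnat x) k a N != 0.

(** For N = 0 the convention S_{p+1} = 1 agrees with the empty minor. *)
Lemma shape_invE (i0 : 'I_m) k N : (k + N = n)%N -> (k <= m)%N -> (N == 0)%N || (k < m)%N ->
  shape_inv x k.+1 = Dmin (xnat x) m k N.
Proof.
move=> kN le_km ok; rewrite /shape_inv; case: ifP => [le_k|/negbT gt_k].
  have [e1 e2] : (n - k.+1 + 1 = N)%N /\ (n - N = k)%N by lia.
  by rewrite e1 -[in RHS]e2; apply: (loop_schur_rect x _ _ i0); lia.
have -> : N = 0%N by lia.
by rewrite Dmin0.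
Qed.

(** For i = 1 the congruence reads K = j - m modulo n. As j - m is negative, its quotient by n is
    -(z + 1) with z >= 0. *)
Lemma redKP j : (0 < j)%N -> (j <= n)%N -> (j < m)%N -> (redK m n 1 j < n)%N /\
  exists z, (m + redK m n 1 j = j + z.+1 * n)%N.
Proof.
move=> j_gt0 le_jn lt_jm; have n_gt0 : (0 < n)%N := leq_trans j_gt0 le_jn.
have n0 : n%:Z != 0 by lia.
set r : int := ((1 + j)%:Z - m%:Z - 1)%R.
have := divz_eq r n%:Z; have := ltz_pmod r (n_gt0 : 0 < n%:Z).
have := modz_ge0 r n0; rewrite /redK -/r.
set K := (r %% n%:Z)%Z; set q := (r %/ n%:Z)%Z => K_ge0 K_lt rE.
split; first by lia.
move: q rE => [q|q] rE; last first.
  by exists q; apply/eqP; rewrite -eqz_nat !PoszD PoszM; apply/eqP; move: rE;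
    rewrite NegzE gez0_abs // mulNr /r; lia.
have : 0 <= q%:Z * n%:Z by [].
by move: rE; rewrite /r; lia.
Qed.

Lemma Qred_minors j : (0 < j)%N -> (j <= n)%N -> (j < m)%N ->
  Qred x 1 j = E1 x j%:Z - rH (xnat x) m j.-1 (n - j)
    - rC (xnat x) m (n - redK m n 1 j) (redK m n 1 j).
Proof.
move=> j_gt0 le_jn lt_jm; have [lt_Kn [z mK]] := redKP j_gt0 le_jn lt_jm.
have m_gt0 : (0 < m)%N by lia.
pose i0 : 'I_m := Ordinal m_gt0.
rewrite /Qred /red_lam /red_mu; set K := redK m n 1 j in lt_Kn mK *.
rewrite (loop_schur_red_minors x j_gt0 le_jn lt_jm lt_Kn mK i0).
rewrite (@shape_invE i0 j (n - j)); [|lia..].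
have -> : (n + 1 - K = (n - K).+1)%N by lia.
have le_nKm : (n - K < m)%N by move: mK; rewrite mulSn; lia.
rewrite (@shape_invE i0 (n - K) K); [|lia..].
have dA : Dmin (xnat x) m j (n - j) != 0 by rewrite D_neq0 //; lia.
have dB : Dmin (xnat x) m (n - K) K != 0 by rewrite D_neq0 //; lia.
have -> : rH (xnat x) m j.-1 (n - j) =
  (if (n - j)%N == 0%N then 0 else Hmin (xnat x) m j.-1 (n - j)) / Dmin (xnat x) m j (n - j).
  by rewrite /rH; case: (n - j)%N => [|N]; rewrite ?mul0r //= prednK.
have -> : rC (xnat x) m (n - K) K =
  (if K == 0%N then 0 else Cmin (xnat x) m (n - K) K) / Dmin (xnat x) m (n - K) K.
  by rewrite /rC; case: (K) => [|N]; rewrite ?mul0r.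
set h := (if (n - j)%N == 0%N then _ else _); set c := (if K == 0%N then _ else _).
by field; rewrite dA dB.
Qed.

End FlagMinors.

(** * Cyclic superscripts and the final summation *)

Section LoopSums.
Variables (F : fieldType) (m n : nat) (x : 'M[F]_(m, n)).
Local Notation X := (xnat x).

Definition xsupn (t : nat) (r : int) : F :=
  if insub t is Some i then xsup x i r else 0.

Lemma xsupnE t p (r : int) : (t < m)%N -> (p < n)%N -> (p + t).+1%:Z = r ->
  xsupn t r = X t p.
Proof.
by move=> lt_tm lt_pn rE; rewrite /xsupn insubT; apply: xsupE.
Qed.

Lemma E1_sum r : E1 x r = \sum_(0 <= t < m) xsupn t r.
Proof. by rewrite big_mkord; apply: eq_bigr => i _; rewrite /xsupn valK. Qed.

Lemma sum_residues (V : nmodType) (f : nat -> V) (h : nat -> nat) :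
    (forall j, (j < n)%N -> (h j < n)%N) ->
    (forall j j', (j < n)%N -> (j' < n)%N -> h j = h j' -> j = j') ->
  \sum_(0 <= j < n) f (h j) = \sum_(0 <= j < n) f j.
Proof.
move=> h_lt h_inj; rewrite !big_mkord.
pose g (j : 'I_n) := Ordinal (h_lt j (ltn_ord j)).
rewrite [RHS](reindex_inj (h := g)) //= => j j' /(congr1 val) /= eq_h.
by apply: val_inj; apply: h_inj; rewrite ?ltn_ord.
Qed.

Definition shift_mod (a j : nat) : nat := absz ((j%:Z - a%:Z) %% n%:Z)%Z.

Lemma shift_modE a j : (0 < n)%N -> (shift_mod a j)%:Z = ((j%:Z - a%:Z) %% n%:Z)%Z.
Proof. by move=> n_gt0; rewrite gez0_abs // modz_ge0; lia. Qed.

Lemma sum_shift_mod (V : nmodType) (f : nat -> V) a :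
  \sum_(0 <= j < n) f (shift_mod a j) = \sum_(0 <= j < n) f j.
Proof.
case: (posnP n) => [n0|n_gt0]; first by rewrite !big_geq //; lia.
apply: sum_residues => [j lt_j|j j' lt_j lt_j' eq_h].
  by rewrite -ltz_nat shift_modE // ltz_pmod.
have : ((j%:Z - a%:Z) %% n%:Z = (j'%:Z - a%:Z) %% n%:Z)%Z by rewrite -!shift_modE // eq_h.
by move/eqP; rewrite eqz_modDr !modz_nat !modn_small // => /eqP[].
Qed.

Lemma xsupn_sum t : (t < m)%N ->
  \sum_(1 <= j < n.+1) xsupn t j%:Z = \sum_(0 <= p < n) X t p.
Proof.
move=> lt_tm; rewrite big_add1 /= -(sum_shift_mod (X t) t).
case: (posnP n) => [n0|n_gt0]; first by rewrite !big_geq //; lia.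
apply: eq_big_nat => j lt_j.
have lt_h : (shift_mod t j < n)%N by rewrite -ltz_nat shift_modE // ltz_pmod.
rewrite -(xsupnE lt_tm lt_h erefl) /xsupn insubT; apply: xsup_mod.
have -> : (shift_mod t j + t).+1%:Z = (shift_mod t j)%:Z + t.+1%:Z by lia.
by rewrite shift_modE // modzDml; congr (_ %% _)%Z; lia.
Qed.

Lemma decorX_E1 : decorX x = \sum_(1 <= j < n.+1) E1 x j%:Z.
Proof.
under [RHS]eq_bigr do rewrite E1_sum.
rewrite exchange_big /decorX big_mkord; apply: eq_bigr => i _ /=.
rewrite xsupn_sum // big_mkord; apply: eq_bigr => j _.
by rewrite xnatE.
Qed.

Lemma E1_subcorner N : (m + N <= n)%N -> (0 < m)%N ->
  Mnat X m (m + N).-1 N = E1 x (m + N)%:Z.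
Proof.
move=> le_n m_gt0; have [m' m'E] : exists m', m = m'.+1 by exists m.-1; lia.
have -> : Mnat X m (m + N).-1 N = Mnat X m'.+1 (N + m') N.
  by congr (Mnat _ _ _ _); lia.
rewrite Mnat_subcorner E1_sum -m'E; apply: eq_big_nat => t lt_t.
by rewrite (@xsupnE t (N + m' - t)) //; lia.
Qed.

(** For a fixed letter t < n, the superscripts j = 1, ..., t wrap to the last t columns, and the
    right-hand side lists these in reverse. For t >= n both sides run over all columns. *)
Lemma sum_xsupn_wrap :
  \sum_(1 <= j < n.+1) \sum_(j <= t < m) xsupn t j%:Z =
  \sum_(1 <= j < n.+1) \sum_(j <= t < m) X t (n - j)%N.
Proof.
have exch (f : nat -> nat -> F) :
    \sum_(1 <= j < n.+1) \sum_(j <= t < m) f j t =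
    \sum_(0 <= t < m) \sum_(1 <= j < n.+1 | (j <= t)%N) f j t.
  transitivity (\sum_(1 <= j < n.+1) \sum_(0 <= t < m | (j <= t)%N) f j t).
    by apply: eq_bigr => j _; rewrite (big_nat_widenl _ 0).
  by rewrite (exchange_big_dep predT).
rewrite !exch; apply: eq_big_nat => t /= lt_tm.
have [le_nt|lt_tn] := leqP n t.
  have full (f : nat -> F) : \sum_(1 <= j < n.+1 | (j <= t)%N) f j =
      \sum_(1 <= j < n.+1) f j.
    by rewrite [LHS]big_nat_cond [RHS]big_nat_cond; apply: eq_bigl => j; lia.
  rewrite !full xsupn_sum // [RHS]big_add1 /= [RHS]big_nat_rev /= add0n.
  by apply: eq_big_nat => p lt_p; congr (X t _); lia.
have part (f : nat -> F) : \sum_(1 <= j < n.+1 | (j <= t)%N) f j =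
    \sum_(1 <= j < t.+1) f j.
  rewrite (big_nat_widen _ t.+1 n.+1); last by lia.
  by apply: eq_bigl => j; rewrite ltnS.
rewrite !part [RHS]big_nat_rev /=; apply: eq_big_nat => j lt_j.
rewrite (_ : j%:Z = j%:Z + n%:Z - n%:Z) ?addrK //.
transitivity (xsupn t (j + n)%:Z).
  by rewrite /xsupn insubT; apply/esym/(@xsup_period _ _ _ _ _ _ _ 1); lia.
by rewrite (@xsupnE t (j + n - t.+1)) ?lt_tm //; [congr (X t _); lia|lia..].
Qed.

(** For m <= n one has n - K = m - j, a reversal of 1, ..., m - 1. For m > n, j runs over all
    residues modulo n, hence so does K. *)
Lemma sum_redK (f : nat -> F) :
  \sum_(1 <= j < n.+1 | (j < m)%N) f (n - redK m n 1 j)%N =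
  \sum_(1 <= j < n.+1 | (j < m)%N) f j.
Proof.
have [le_mn|lt_nm] := leqP m n.
  have part (g : nat -> F) : \sum_(1 <= j < n.+1 | (j < m)%N) g j =
      \sum_(1 <= j < m) g j.
    by rewrite [RHS](big_nat_widen _ _ n.+1) //; lia.
  rewrite !part [RHS]big_nat_rev /=; apply: eq_big_nat => j lt_j.
  have [|||lt_K [[|z] mK]] := redKP (m := m) (n := n) (j := j); [lia..| |].
    by congr (f _); lia.
  by move: mK; rewrite !mulSn; lia.
have full (g : nat -> F) : \sum_(1 <= j < n.+1 | (j < m)%N) g j =
    \sum_(1 <= j < n.+1) g j.
  by rewrite [LHS]big_nat_cond [RHS]big_nat_cond; apply: eq_bigl => j; lia.
rewrite !full [LHS]big_add1 /= [RHS]big_add1 /= [RHS]big_nat_rev /= add0n.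
rewrite -(sum_shift_mod (fun k => f (n - k.+1).+1) m.-1); apply: eq_big_nat => j lt_j.
have [|||lt_K _] := redKP (m := m) (n := n) (j := j.+1); [lia..|].
have -> : shift_mod m.-1 j = redK m n 1 j.+1.
  by rewrite /shift_mod /redK; congr (absz (_ %% _)%Z); lia.
by congr (f _); lia.
Qed.

(** The letters t < j do not wrap, and their variables sum to the subcorner entry of M_j. *)
Lemma E1_wrap j : (0 < j)%N -> (j <= n)%N -> (j < m)%N ->
  E1 x j%:Z = Mnat X j j.-1 0 + \sum_(j <= t < m) xsupn t j%:Z.
Proof.
case: j => [//|j] _ lt_jn lt_jm; rewrite E1_sum (@big_cat_nat _ _ _ j.+1) //=; last exact: ltnW.
congr (_ + _); rewrite -[j in Mnat _ _ j]add0n Mnat_subcorner; apply: eq_big_nat => t lt_t.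
by rewrite (@xsupnE t (0 + j - t)) //; lia.
Qed.

Hypotheses (m_gt0 : (0 < m)%N) (n_gt0 : (0 < n)%N).
Hypothesis D_neq0 : forall k a N,
  (k <= m)%N -> (a <= k)%N -> (a + N <= n)%N -> Dmin X k a N != 0.

Lemma sum_Qred : \sum_(1 <= j < (minn (m - 1) n).+1) Qred x 1 j =
  \sum_(1 <= j < n.+1 | (j < m)%N)
    (E1 x j%:Z - rH X m j.-1 (n - j) - rC X m j (n - j)).
Proof.
rewrite (big_nat_widen _ _ n.+1); last by lia.
transitivity (\sum_(1 <= j < n.+1 | (j < m)%N) (E1 x j%:Z - rH X m j.-1 (n - j)
    - rC X m (n - redK m n 1 j) (redK m n 1 j))).
  rewrite [LHS]big_nat_cond [RHS]big_nat_cond.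
  apply: eq_big => [j|j cond_j]; first by lia.
  by rewrite Qred_minors //; lia.
rewrite !sumrB; congr (_ - _).
rewrite -(sum_redK (fun j => rC X m j (n - j))).
rewrite [LHS]big_nat_cond [RHS]big_nat_cond; apply: eq_bigr => j cond_j.
by have [|||lt_K _] := redKP (m := m) (n := n) (j := j); [lia..|rewrite subKn // ltnW].
Qed.

Lemma decorQ_sum : decorQ m n (Qpat x) =
  \sum_(1 <= j < n.+1 | (j < m)%N)
    (E1 x j%:Z - rH X m j.-1 (n - j) - rC X m j (n - j)).
Proof.
rewrite decorQ_pat // (decorQ_minors D_neq0) //.
rewrite -sum_xsupn_wrap.
have -> : \sum_(1 <= j < n.+1) \sum_(j <= t < m) xsupn t j%:Z =
    \sum_(1 <= j < n.+1 | (j < m)%N) \sum_(j <= t < m) xsupn t j%:Z.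
  rewrite [RHS]big_mkcond; apply: eq_bigr => j _.
  by case: ltnP => // le_mj; rewrite big_geq.
rewrite -big_split big_nat_cond [RHS]big_nat_cond; apply: eq_bigr => j cond_j /=.
by rewrite E1_wrap; [ring|lia..].
Qed.

(** Where the minimum is m, the ratio is a corner value, namely a subcorner entry of M_m equal to
    E_1^(m+k). *)
Lemma sum_rC_corner :
  \sum_(1 <= k < n) rC X m (minn m (n - k)) k =
  \sum_(1 <= j < n.+1 | (j < m)%N) rC X m j (n - j)
    + \sum_(m.+1 <= r < n.+1) E1 x r%:Z.
Proof.
rewrite [LHS]big_nat_rev /=.
have -> : \sum_(1 <= k < n) rC X m (minn m (n - (1 + n - k.+1))) (1 + n - k.+1) =
    \sum_(1 <= k < n) rC X m (minn m k) (n - k).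
  by apply: eq_big_nat => k lt_k; congr (rC _ _ _ _); lia.
have [le_mn|lt_nm] := leqP m n; last first.
  rewrite [X in _ + X]big_geq ?addr0; last by lia.
  transitivity (\sum_(1 <= j < n.+1) rC X m j (n - j)).
    rewrite big_nat_recr //= subnn /= addr0.
    by apply: eq_big_nat => j lt_j; congr (rC _ _ _ _); lia.
  by rewrite [LHS]big_nat_cond [RHS]big_nat_cond; apply: eq_bigl => j; lia.
rewrite (@big_cat_nat _ _ _ m) //=; congr (_ + _).
  transitivity (\sum_(1 <= j < m) rC X m j (n - j)).
    by apply: eq_big_nat => j lt_j; congr (rC _ _ _ _); lia.
  by rewrite [LHS](big_nat_widen _ _ n.+1) //; lia.
rewrite [RHS]big_add1 /= [RHS]big_nat_rev /=; apply: eq_big_nat => j lt_j.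
have -> : minn m j = m by lia.
have -> : (m + n - j.+1).+1 = (m + (n - j))%N by lia.
rewrite -E1_subcorner //; last by lia.
have [N NE] : exists N, (n - j)%N = N.+1 by exists (n - j).-1; lia.
by rewrite NE /rC Cmin_corner Dmin_corner divr1 addnS.
Qed.

Lemma E1_total : \sum_(1 <= j < n.+1) E1 x j%:Z =
  \sum_(1 <= j < n.+1 | (j < m)%N) E1 x j%:Z
    + (if (m <= n)%N then E1 x m%:Z else 0)
    + \sum_(m.+1 <= r < n.+1) E1 x r%:Z.
Proof.
have [le_mn|lt_nm] := leqP m n; last first.
  rewrite addr0 [X in _ + X]big_geq ?addr0; last by lia.
  by rewrite [LHS]big_nat_cond [RHS]big_nat_cond; apply: eq_bigl => j; lia.
rewrite (@big_cat_nat _ _ _ m) //=; last by lia.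
rewrite -addrA -big_ltn //; congr (_ + _).
by rewrite [LHS](big_nat_widen _ _ n.+1) //; lia.
Qed.

Lemma central_charge_sum : central_charge x =
  \sum_(1 <= j < n.+1 | (j < m)%N)
    (E1 x j%:Z - rH X m j.-1 (n - j) - rC X m j (n - j))
  + (if m == n then 1 else 0) * E1 x n%:Z.
Proof.
rewrite /central_charge decorX_E1 decorP_pat // (decorP_minors D_neq0) //.
have -> : \sum_(1 <= i < m) rH X m i.-1 (n - i) =
    \sum_(1 <= j < n.+1 | (j < m)%N) rH X m j.-1 (n - j).
  have [le_mn|lt_nm] := leqP m n.
    by rewrite [LHS](big_nat_widen _ _ n.+1) //; lia.
  have tail0 : \sum_(n.+1 <= i < m) rH X m i.-1 (n - i) = 0.
    rewrite big_nat_cond big1 // => i lt_i.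
    by rewrite (_ : (n - i = 0)%N) //; lia.
  rewrite (@big_cat_nat _ _ _ n.+1) //= tail0 addr0.
  by rewrite [LHS]big_nat_cond [RHS]big_nat_cond; apply: eq_bigl => j; lia.
have -> : (if (m < n)%N then Mnat X m m.-1 0 else 0) =
    (if (m < n)%N then E1 x m%:Z else 0).
  by case: ifP => // lt_mn; rewrite -[m in E1 _ m%:Z]addn0 -E1_subcorner ?addn0 // ltnW.
(* The sums over r > m cancel in all cases. E_1^(m) cancels for m < n, is absent for m > n and
   survives for m = n. *)
rewrite sum_rC_corner E1_total !sumrB; case: (ltngtP m n) => [lt_mn|lt_nm|eq_mn].
- by ring.
- by ring.
have -> : E1 x n%:Z = E1 x m%:Z by congr (E1 x _); lia.
by ring.
Qed.

End LoopSums.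

Lemma Mnat_map (R S : comNzRingType) (f : {rmorphism R -> S}) X k a b :
  Mnat (fun t p => f (X t p)) k a b = f (Mnat X k a b).
Proof.
elim: k b => [|k IH] b; first by rewrite /Mnat rmorph_nat.
by rewrite !MnatS !IH rmorphD rmorphM.
Qed.

Lemma Dmin_map (R S : comNzRingType) (f : {rmorphism R -> S}) X k a N :
  Dmin (fun t p => f (X t p)) k a N = f (Dmin X k a N).
Proof.
rewrite /Dmin /dcol -det_map_mx; congr (\det _); apply/matrixP => r c.
by rewrite !mxE Mnat_map.
Qed.

(* Setting the first [a] rows of variables to 0 and the others to 1 turns M
   into a unitriangular matrix shifted down by [a]. *)
Lemma Dmin_shift (R : comNzRingType) (X : nat -> nat -> R) m n k a N :
    (forall t p, (t < m)%N -> (p < n)%N -> X t p = (a <= t)%N%:R) ->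
    (k <= m)%N -> (a <= k)%N -> (a + N <= n)%N ->
  Dmin X k a N = 1.
Proof.
move=> XE le_km le_ak le_n.
have below l b c : (b < n)%N -> (l <= a)%N -> Mnat X l b c = (b == c + l)%N%:R.
  move=> lt_bn; elim: l c => [|l IH] c le_la; first by rewrite addn0.
  rewrite MnatS !IH ?(ltnW le_la) // addSnnS.
  have [lt_cn|le_nc] := ltnP c n.
    have -> : X l c = 0 by rewrite XE ?(leqNgt a) ?le_la //; lia.
    by rewrite mul0r add0r.
  by rewrite (_ : (b == c + l)%N = false) ?mulr0 ?add0r //; lia.
have above d b c : (b < n)%N -> (a + d <= m)%N -> (b <= c + a)%N ->
    Mnat X (a + d) b c = (b == c + a)%N%:R.
  move=> lt_bn; elim: d c => [|d IH] c le_m le_b; first by rewrite addn0 below.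
  rewrite addnS MnatS !IH; try lia.
  rewrite (_ : (b == c.+1 + a)%N = false) ?addr0; last by lia.
  case: eqP => [eq_b|_]; last by rewrite mulr0.
  by rewrite XE ?leq_addr ?mulr1 //; lia.
rewrite /Dmin /dcol det_trig => [|]; last first.
  apply/is_trig_mxP => r c lt_rc; have lt_cN := ltn_ord c.
  by rewrite mxE -(subnKC le_ak) above; [rewrite (_ : (_ == _) = false) //; lia|lia..].
apply: big1 => r _; have lt_rN := ltn_ord r.
by rewrite mxE -(subnKC le_ak) above; [rewrite addnC eqxx|lia..].
Qed.

Section Indeterminates.
Variables (R : realType) (m n : nat).
Local Notation P := {mpoly R[i][m * n]}.

(** Polynomial lift of [xnat]: the minors become images of polynomials, to which evaluation at a
    point applies. *)
Definition mvar (t p : nat) : P :=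
  if insub t is Some i then
    if insub p is Some j then 'X_(mxvec_index (i : 'I_m) (j : 'I_n)) else 0
  else 0.

Lemma xnat_indets : xnat (indets R m n) = fun t p => tofrac (mvar t p).
Proof.
apply/funext => t; apply/funext => p; rewrite /xnat /mvar.
case: insubP => [i _ _|_]; last by rewrite rmorph0.
case: insubP => [j _ _|_]; last by rewrite rmorph0.
by rewrite mxE.
Qed.

Lemma Dmin_indets_neq0 k a N : (k <= m)%N -> (a <= k)%N -> (a + N <= n)%N ->
  Dmin (xnat (indets R m n)) k a N != 0.
Proof.
move=> le_km le_ak le_n; rewrite xnat_indets (Dmin_map _ mvar) tofrac_eq0.
pose v (l : 'I_(m * n)) : R[i] := mxvec (\matrix_(i < m, j < n) (a <= i)%N%:R) 0 l.
apply/negP => /eqP /(congr1 (meval v)); rewrite rmorph0 -Dmin_map.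
rewrite (@Dmin_shift _ _ m n) // => [/eqP|t p lt_t lt_p]; first by rewrite oner_eq0.
by rewrite /mvar !insubT /= mevalXU /v mxvecE mxE.
Qed.

End Indeterminates.

Theorem theorem7p3 (R : realType) (m n : nat) (hm : (1 <= m)%N) (hn : (1 <= n)%N) :
  let x := indets R m n in
  central_charge x
    = \sum_(1 <= j < (minn (m - 1) n).+1) Qred x 1 j
      + (if m == n then 1 else 0) * E1 x n%:Z
  /\
  decorQ m n (Qpat x) = \sum_(1 <= j < (minn (m - 1) n).+1) Qred x 1 j.
Proof.
move=> x; have D_neq0 := @Dmin_indets_neq0 R m n.
by rewrite (sum_Qred hm hn D_neq0) (central_charge_sum hm hn D_neq0) (decorQ_sum hm hn D_neq0).
Qed.
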